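(* Let $0<T_{min}\le T_{max}<\infty$ be given. Then the following statements are equivalent: (a) There exist matrices $P_i\in\mathbb{S}^{n+m}_{\succ0}$, $K_{j,i}\in\mathbb{R}^{m\times(n+m)}$, $i,j=1,\ldots,N$, and a nonnegative matrix $\Pi=[\pi_{ij}]\in\mathbb{R}^{N\times N}$ verifying $\mathbf{1}_N^T\Pi=\mathbf{1}_N^T$ such that, with $\bar J_{j,i}=\bar J_{j,i}^0+\bar J_{j,i}^1K_{j,i}$, $$e^{\bar A_i^T\theta}\left(\sum_{j=1}^N\pi_{ji}\bar J_{j,i}^TP_j\bar J_{j,i}\right)e^{\bar A_i\theta}-P_i\prec0$$ holds for all $i=1,\ldots,N$ and all $\theta\in[T_{min},T_{max}]$. (b) There exist scalars $\varepsilon>0$ and $d\in\mathbb{Z}_{\ge0}$ such that the following sum of squares program is feasible using polynomial matrices of degree (at most) $2d$: find symmetric matrix-valued polynomial functions $\tilde S_i,\Gamma_i,\Delta_i:\mathbb{R}\to\mathbb{S}^{n+m}$, constant matrices $\tilde P_i\in\mathbb{S}^{n+m}$ and $U_{j,i}\in\mathbb{R}^{m\times(n+m)}$, $i,j=1,\ldots,N$, and a nonnegative matrix $\Pi=[\pi_{ij}]\in\mathbb{R}^{N\times N}$ with $\mathbf{1}_N^T\Pi=\mathbf{1}_N^T$ such that, for all $i=1,\ldots,N$: - $\Gamma_i(\cdot)$ and $\Delta_i(\cdot)$ are SOS matrices, - $\tilde P_i-\varepsilon I$ is an SOS matrix, - $-\dot{\tilde S}_i(\tau)-\big(\tilde S_i(\tau)\bar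 A_i^T+\bar A_i\tilde S_i(\tau)\big)-\Gamma_i(\tau)g(\tau)$ is an SOS matrix (in $\tau$), - $-\tilde P_i+\tilde S_i(\theta)-\varepsilon I-\Delta_i(\theta)h(\theta)$ is an SOS matrix (in $\theta$), - $\begin{bmatrix}\tilde S_i(0)&V_i^T\\ V_i&\operatorname{diag}_{j=1}^N\{\tilde P_j\}\end{bmatrix}$ is an SOS matrix, where $V_i=\operatorname{col}_{j=1}^N\{\pi_{ji}^{1/2}[\bar J_{j,i}^0\tilde S_i(0)+\bar J_{j,i}^1U_{j,i}]\}$.
   Context: $\mathbb{S}^{q}$ is the set of real symmetric $q\times q$ matrices, $\mathbb{S}^{q}_{\succ0}$ the positive definite ones; $X\prec0$ means negative definite. $\mathbf{1}_N$ is the $N$-vector of ones. A nonnegative matrix is a matrix with nonnegative entries. $\operatorname{diag}_{j=1}^N\{X_j\}$ is the block-diagonal matrix with blocks $X_1,\ldots,X_N$ and $\operatorname{col}_{j=1}^N\{X_j\}$ is the block column obtained by stacking $X_1,\ldots,X_N$. A dot denotes differentiation with respect to the argument. Data: integers $n,m,N\ge1$ and real matrices $A_i\in\mathbb{R}^{n\times n}$, $B_i\in\mathbb{R}^{n\times m}$, $J_{j,i}\in\mathbb{R}^{n\times n}$, $i,j=1,\ldots,N$, and $$\bar A_i=\begin{bmatrix}A_i&B_i\\ 0&0\end{bmatrix},\qquad \bar J_{j,i}^0=\begin{bmatrix}J_{j,i}&0\\ 0&0\end{bmatrix},\qquad \bar J_{j,i}^1=\begin{bmatrix}0\\ I_m\end{bmatrix}.$$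 The polynomials $g,h$ are $$g(\tau):=\tau(T_{max}-\tau),\qquad h(\theta):=(\theta-T_{min})(T_{max}-\theta).$$ A symmetric (univariate, real) polynomial matrix $\Theta(\cdot)$ is called a sum of squares (SOS) matrix if there exists a (not necessarily square) polynomial matrix $\Xi(\cdot)$ such that $\Theta(\cdot)=\Xi(\cdot)^T\Xi(\cdot)$; a constant matrix is regarded as a polynomial matrix of degree zero. ''Using polynomial matrices of degree (at most) $2d$'' refers to the unknown polynomial matrices $\tilde S_i,\Gamma_i,\Delta_i$. *)

(* Defs.v *)
From HB Require Import structures.
From mathcomp Require Import all_boot all_order all_algebra.
From mathcomp Require Import all_classical all_reals all_analysis.

Set Implicit Arguments.
Unset Strict Implicit.
Unset Printing Implicit Defensive.

Import Order.TTheory GRing.Theory Num.Theory.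
Import numFieldNormedType.Exports.

Local Open Scope ring_scope.
Local Open Scope classical_set_scope.

Definition posdefmx (R : realType) (q : nat) (X : 'M[R]_q) : Prop :=
  X^T = X /\
  forall x : 'cV[R]_q, x != 0 -> 0 < (x^T *m X *m x) 0 0.

Definition negdefmx (R : realType) (q : nat) (X : 'M[R]_q) : Prop :=
  X^T = X /\
  forall x : 'cV[R]_q, x != 0 -> (x^T *m X *m x) 0 0 < 0.

(* The limit is taken in the normed space of matrices. *)
Definition expmx (R : realType) (q : nat) (X : 'M[R]_q) : 'M[R]_q :=
  limn (series (fun k : nat => k`!%:R^-1 *: X ^+ k)).

(* A polynomial matrix is a matrix with entries in {poly R}, identified with
   the matrix-valued function it defines since R is infinite. *)
Definition pconst (R : realType) (p q : nat) (X : 'M[R]_(p, q))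
  : 'M[{poly R}]_(p, q) := map_mx polyC X.

Definition peval (R : realType) (p q : nat) (X : 'M[{poly R}]_(p, q)) (t : R)
  : 'M[R]_(p, q) := map_mx (horner_eval t) X.

Definition pderiv (R : realType) (p q : nat) (X : 'M[{poly R}]_(p, q))
  : 'M[{poly R}]_(p, q) := map_mx (@deriv R) X.

(* [size] is the degree plus one, and 0 for the zero polynomial. *)
Definition pdeg_le (R : realType) (p q : nat) (X : 'M[{poly R}]_(p, q))
    (k : nat) : Prop :=
  forall i j, (size (X i j) <= k.+1)%N.

(* The factor Xi may have any number of rows, and is polynomial even when
   Theta is constant. *)
Definition SOSmx (R : realType) (q : nat) (Theta : 'M[{poly R}]_q) : Prop :=
  exists (p : nat) (Xi : 'M[{poly R}]_(p, q)), Theta = Xi^T *m Xi.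

Definition gpoly (R : realType) (Tmax : R) : {poly R} := 'X * (Tmax%:P - 'X).

Definition hpoly (R : realType) (Tmin Tmax : R) : {poly R} :=
  ('X - Tmin%:P) * (Tmax%:P - 'X).

Definition Abar (R : realType) (n m : nat) (A : 'M[R]_n) (B : 'M[R]_(n, m))
  : 'M[R]_(n + m) := block_mx A B 0 0.

Definition Jbar0 (R : realType) (n m : nat) (J : 'M[R]_n) : 'M[R]_(n + m) :=
  block_mx J 0 0 0.

Definition Jbar1 (R : realType) (n m : nat) : 'M[R]_(n + m, m) :=
  col_mx 0 1%:M.

Definition Jbar (R : realType) (n m : nat) (J : 'M[R]_n)
    (K : 'M[R]_(m, n + m)) : 'M[R]_(n + m) :=
  Jbar0 m J + Jbar1 R n m *m K.

Definition col_stochastic (R : realType) (N : nat) (Pi : 'M[R]_N) : Prop :=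
  (forall i j, 0 <= Pi i j) /\
  (const_mx 1 : 'cV[R]_N)^T *m Pi = (const_mx 1 : 'cV[R]_N)^T.

Definition Vcol (R : realType) (n m N : nat) (J : 'I_N -> 'M[R]_n)
    (p : 'I_N -> R) (S0 : 'M[R]_(n + m)) (U : 'I_N -> 'M[R]_(m, n + m))
  : 'M[R]_(\sum_(j < N) (n + m), n + m) :=
  \mxcol_(j < N)
    (Num.sqrt (p j) *: (Jbar0 m (J j) *m S0 + Jbar1 R n m *m U j)).

(* Main.v *)
(* Write Q_i for the matrix called P tilde_i in (b), put P_i = Q_i^-1, let
   E_t = exp(t Abar_i) and let M be the sum over j in (a).

   (b) => (a). The differential inequality makes E_t S(t) E_t^T nonincreasing on
   [0, Tmax], so S(0) >= E_t (Q + eps) E_t^T for t in [Tmin, Tmax]. With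
   K = U S(0)^-1, the Schur complement of the last condition reads
   S(0) M S(0) <= S(0). Young's inequality 2 w.x <= w.Qw + x.Q^-1 x then gives
   E_t^T M E_t < Q^-1.

   (a) => (b). Take S(t) = (1 - eta t) G_t (M + delta)^-1 G_t^T, where G_t is a
   truncation of the series of exp(- t Abar_i). For small delta, small eta and a
   late truncation the required inequalities hold on compact intervals with a
   uniform positive margin. A polynomial matrix F >= c > 0 on [0, 1] has
   positive definite Bernstein coefficients of some even degree 2r, and
   t^k (1 - t)^(2r - k) is a square or t (1 - t) times a square, which yields
   F = s0 + t (1 - t) s1 with s0 and s1 SOS. *)

Require Import Defs.
From HB Require Import structures.
From mathcomp Require Import all_boot all_order all_algebra.
From mathcomp Require Import all_classical all_reals all_analysis.
From mathcomp Require Import polyrcf zify ring lra.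

Set Implicit Arguments.
Unset Strict Implicit.
Unset Printing Implicit Defensive.

Import Order.TTheory GRing.Theory Num.Theory.
Import numFieldNormedType.Exports.

Local Open Scope ring_scope.

(** * Quadratic forms and positive definite matrices *)

Section QuadraticForms.
Variable R : realType.
Implicit Types (p q : nat).

Definition dot q (u v : 'cV[R]_q) : R := (u^T *m v) 0 0.

Lemma dotE q (u v : 'cV[R]_q) : dot u v = \sum_i u i 0 * v i 0.
Proof. by rewrite /dot mxE; apply: eq_bigr => i _; rewrite mxE. Qed.

Lemma dotC q (u v : 'cV[R]_q) : dot u v = dot v u.
Proof. by rewrite !dotE; apply: eq_bigr => i _; rewrite mulrC. Qed.

Lemma dotDl q (u v w : 'cV[R]_q) : dot (u + v) w = dot u w + dot v w.
Proof. by rewrite /dot linearD mulmxDl mxE. Qed.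

Lemma dotDr q (u v w : 'cV[R]_q) : dot w (u + v) = dot w u + dot w v.
Proof. by rewrite /dot mulmxDr mxE. Qed.

Lemma dotZl q a (u v : 'cV[R]_q) : dot (a *: u) v = a * dot u v.
Proof. by rewrite /dot linearZ -scalemxAl mxE. Qed.

Lemma dotZr q a (u v : 'cV[R]_q) : dot u (a *: v) = a * dot u v.
Proof. by rewrite /dot -scalemxAr mxE. Qed.

Lemma dotNl q (u v : 'cV[R]_q) : dot (- u) v = - dot u v.
Proof. by rewrite -scaleN1r dotZl mulN1r. Qed.

Lemma dotNr q (u v : 'cV[R]_q) : dot u (- v) = - dot u v.
Proof. by rewrite -scaleN1r dotZr mulN1r. Qed.

Lemma dot_sumr q I (r : seq I) (F : I -> 'cV[R]_q) u :
  dot u (\sum_(i <- r) F i) = \sum_(i <- r) dot u (F i).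
Proof.
elim: r => [|i r IH]; last by rewrite !big_cons dotDr IH.
by rewrite !big_nil /dot mulmx0 mxE.
Qed.

Lemma dot_adj p q (L : 'M[R]_(p, q)) u v : dot (L *m u) v = dot u (L^T *m v).
Proof. by rewrite /dot trmx_mul mulmxA. Qed.

Lemma dot_ge0 q (u : 'cV[R]_q) : 0 <= dot u u.
Proof. by rewrite dotE sumr_ge0 // => i _; rewrite -expr2 sqr_ge0. Qed.

Lemma dot_gt0 q (u : 'cV[R]_q) : u != 0 -> 0 < dot u u.
Proof.
move=> u0; rewrite lt_neqAle dot_ge0 andbT eq_sym.
apply: contra u0; rewrite dotE psumr_eq0; last first.
  by move=> i _; rewrite -expr2 sqr_ge0.
move=> /allP u0; apply/eqP/colP => i; rewrite mxE; apply/eqP.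
by have := u0 i (mem_index_enum _); rewrite /= mulf_eq0 orbb.
Qed.

Lemma posdefmxP q (X : 'M[R]_q) :
  posdefmx X <-> X^T = X /\ forall x, x != 0 -> 0 < dot x (X *m x).
Proof.
by split=> -[XT Xx]; split=> // x x0; move: (Xx x x0); rewrite /dot mulmxA.
Qed.

Lemma negdefmxP q (X : 'M[R]_q) :
  negdefmx X <-> X^T = X /\ forall x, x != 0 -> dot x (X *m x) < 0.
Proof.
by split=> -[XT Xx]; split=> // x x0; move: (Xx x x0); rewrite /dot mulmxA.
Qed.

(** Positivity is carried with an explicit margin [c], so that uniformity in a parameter and
    stability under small perturbations can be expressed. Symmetry is tracked separately. *)
Definition lowbd q (c : R) (X : 'M[R]_q) :=
  forall x, c * dot x x <= dot x (X *m x).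

Lemma lowbd_le q c c' (X : 'M[R]_q) : c' <= c -> lowbd c X -> lowbd c' X.
Proof.
by move=> cc Xc x; apply: le_trans (Xc x); rewrite ler_wpM2r ?dot_ge0.
Qed.

Lemma lowbd_posdef q c (X : 'M[R]_q) :
  X^T = X -> 0 < c -> lowbd c X -> posdefmx X.
Proof.
move=> XT c0 Xc; apply/posdefmxP; split=> // x x0.
by apply: lt_le_trans (Xc x); rewrite mulr_gt0 ?dot_gt0.
Qed.

Lemma lowbdD q c d (X Y : 'M[R]_q) :
  lowbd c X -> lowbd d Y -> lowbd (c + d) (X + Y).
Proof.
by move=> Xc Yd x; rewrite mulmxDl dotDr mulrDl lerD.
Qed.

Lemma dot_scalar q c (x : 'cV[R]_q) : dot x (c%:M *m x) = c * dot x x.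
Proof. by rewrite mul_scalar_mx dotZr. Qed.

Lemma lowbd_scalar q c : lowbd c (c%:M : 'M[R]_q).
Proof. by move=> x; rewrite dot_scalar. Qed.

(** Each product of two coordinates of [x] is at most half the sum of their squares; in the double
    sum every square then collects total weight [q]. *)
Lemma dot_mx_le q e (X : 'M[R]_q) x : (forall i j, `|X i j| <= e) ->
  `|dot x (X *m x)| <= e * q%:R * dot x x.
Proof.
move=> Xe.
have -> : dot x (X *m x) = \sum_i \sum_j x i 0 * X i j * x j 0.
  rewrite dotE; apply: eq_bigr => i _; rewrite mxE mulr_sumr.
  by apply: eq_bigr => j _; rewrite mulrA.
apply: le_trans (ler_norm_sum _ _ _) _.
apply: (@le_trans _ _ (\sum_i \sum_j e * ((x i 0 ^+ 2 + x j 0 ^+ 2) / 2))).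
  apply: ler_sum => i _; apply: le_trans (ler_norm_sum _ _ _) _.
  apply: ler_sum => j _; rewrite !normrM mulrAC mulrC.
  apply: ler_pM; rewrite ?mulr_ge0 //.
  have := sqr_ge0 (`|x i 0| - `|x j 0|).
  rewrite -(real_normK (num_real (x i 0))) -(real_normK (num_real (x j 0))).
  by nra.
rewrite le_eqVlt; apply/orP; left; apply/eqP; rewrite dotE.
under eq_bigr do rewrite -mulr_sumr -mulr_suml big_split /=.
rewrite -mulr_sumr -mulr_suml big_split /= -mulrA; congr (_ * _).
under eq_bigr do rewrite sumr_const card_ord -mulr_natl.
rewrite sumr_const card_ord -[X in _ + X]mulr_natl -mulr_sumr.
under [in RHS]eq_bigr do rewrite -expr2.
by field.
Qed.

Lemma lowbd_near q c e (X Y : 'M[R]_q) : lowbd c X ->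
  (forall i j, `|Y i j - X i j| <= e) -> lowbd (c - e * q%:R) Y.
Proof.
move=> Xc YX x.
have: `|dot x ((Y - X) *m x)| <= e * q%:R * dot x x.
  by apply: dot_mx_le => i j; rewrite !mxE.
rewrite mulmxBl dotDr dotNr => /ler_normlP[+ _].
by have := Xc x; rewrite mulrBl; lra.
Qed.

(** Cholesky induction: completing the square in the first variable splits off [r^T *m r] divided by
    the pivot [a 0 0] and leaves the Schur complement [C'], again positive definite and one size
    smaller. *)
Lemma posdef_gram q (X : 'M[R]_q) : posdefmx X ->
  exists p (L : 'M[R]_(p, q)), X = L^T *m L.
Proof.
elim: q X => [|q IH] X.
  by exists 0%N, 0; apply/matrixP=> -[].
move=> /posdefmxP; rewrite -[q.+1]/(1 + q)%N in X *; move=> -[XT Xx].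
have [a [b [C XE]]] :
    exists (a : 'M[R]_1) (b : 'rV[R]_q) (C : 'M[R]_q), X = block_mx a b b^T C.
  exists (ulsubmx X), (ursubmx X), (drsubmx X).
  by rewrite -[LHS]submxK trmx_ursub XT.
have CT : C^T = C.
  by have := congr1 drsubmx XT; rewrite XE tr_block_mx !block_mxKdr.
have aE : a = (a 0 0)%:M by rewrite [LHS]mx11_scalar.
have a0 : 0 < a 0 0.
  have := Xx (col_mx 1 0) _; rewrite XE mul_block_col !mulmx0 !addr0 !mulmx1.
  rewrite /dot tr_col_mx mul_row_col trmx0 mul0mx addr0 trmx1 mul1mx.
  apply; apply/eqP => /(congr1 usubmx); rewrite col_mxKu linear0 => /eqP.
  by rewrite oner_eq0.
pose r := row_mx a b.
pose C' := C - (a 0 0)^-1 *: (b^T *m b).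
have aT : a^T = a by rewrite aE tr_scalar_mx.
have XE2 : X = (a 0 0)^-1 *: (r^T *m r) + block_mx 0 0 0 C'.
  rewrite /r tr_row_mx mul_col_row scale_block_mx add_block_mx !addr0 XE.
  rewrite addrCA subrr addr0 aT aE mul_scalar_mx mul_mx_scalar.
  rewrite mul_scalar_mx !scalerA !mxE eqxx mulr1n mulVf ?gt_eqF //.
  by rewrite !scale1r.
have [|p [L' L'E]] := IH C'.
  apply/posdefmxP; split.
    rewrite /C' linearB linearZ /= trmx_mul trmxK; congr (_ - _).
    by rewrite CT.
  move=> y y0.
  (* This first coordinate makes [r *m x] vanish, so the form of [X] at [x] equals that of [C'] at
     [y]. *)
  pose x := col_mx (- (a 0 0)^-1 *: (b *m y)) y.
  have := Xx x _; rewrite XE2 mulmxDl dotDr -scalemxAl dotZr -mulmxA.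
  have -> : r *m x = 0.
    rewrite /r /x mul_row_col aE mul_scalar_mx scalerA !mxE eqxx mulr1n mulrN.
    by rewrite divff ?gt_eqF // scaleN1r addNr.
  rewrite mulmx0 [dot x 0]/dot mulmx0 mxE mulr0 add0r.
  rewrite /x mul_block_col !mul0mx !addr0 add0r /dot tr_col_mx mul_row_col.
  rewrite mulmx0 add0r; apply.
  apply/eqP => /(congr1 dsubmx); rewrite col_mxKd linear0 => /eqP.
  by rewrite (negPf y0).
exists (1 + p)%N, (col_mx (Num.sqrt (a 0 0)^-1 *: r) (row_mx 0 L')).
rewrite tr_col_mx mul_row_col [(_ *: r)^T]linearZ -scalemxAr -scalemxAl scalerA.
rewrite -expr2 sqr_sqrtr ?invr_ge0 ?ltW // XE2; congr (_ + _).
by rewrite tr_row_mx mul_col_row trmx0 !mul0mx !mulmx0 -L'E.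
Qed.

Lemma posdef_unit q (X : 'M[R]_q) : posdefmx X -> X \in unitmx.
Proof.
move=> /posdefmxP[XT Xx]; rewrite unitmxE unitfE; apply/negP => /det0P[v v0 vX].
have := Xx v^T; rewrite trmx_eq0 => /(_ v0).
by rewrite -XT -trmx_mul vX trmx0 /dot mulmx0 mxE ltxx.
Qed.

Lemma posdef_inv q (X : 'M[R]_q) : posdefmx X -> posdefmx (invmx X).
Proof.
move=> X0; have Xu := posdef_unit X0; have [XT Xx] := (posdefmxP X).1 X0.
apply/posdefmxP; split; first by rewrite trmx_inv XT.
move=> x x0; have := Xx (invmx X *m x) _; rewrite mulKVmx // dotC; apply.
by apply: contra x0 => /eqP x0; rewrite -(mulKVmx Xu x) x0 mulmx0.
Qed.

(** For [X = L^T *m L], the matrix [Y] recovers [x] linearly from [L *m x]. Hence the squared norm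
    of [x] is at most a constant times that of [L *m x], which is the form of [X] at [x]. *)
Lemma posdef_lowbd q (X : 'M[R]_q) : posdefmx X ->
  exists2 c, 0 < c & lowbd c X.
Proof.
move=> X0; have Xu := posdef_unit X0.
have [p [L XE]] := posdef_gram X0.
pose Y := invmx X *m L^T.
(* The added [1] in [e] and in [C] keeps both strictly positive, even for empty matrices. *)
pose e := 1 + \sum_i \sum_j `|(Y^T *m Y) i j|.
have e1 : 0 < e by rewrite ltr_pwDl // !sumr_ge0 // => *; rewrite sumr_ge0.
pose C := e * (1 + p%:R).
have C0 : 0 < C by rewrite mulr_gt0 // ltr_pwDl.
exists C^-1; rewrite ?invr_gt0 // => x; rewrite mulrC ler_pdivrMr //.
set y := L *m x.
have xE : x = Y *m y by rewrite mulmxA /Y -[_ *m L]mulmxA -XE mulVmx ?mul1mx.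
have -> : dot x (X *m x) = dot y y by rewrite dot_adj mulmxA -XE.
rewrite [in leLHS]xE dot_adj mulmxA [leRHS]mulrC.
apply: le_trans (ler_norm _) _.
apply: le_trans (dot_mx_le (e := e) _ _) _.
  move=> i j; rewrite /e ler_wpDl // (bigD1 i) //= (bigD1 j) //= -addrA lerDl.
  by rewrite addr_ge0 ?sumr_ge0 // => *; rewrite sumr_ge0.
rewrite ler_wpM2r ?dot_ge0 // ler_wpM2l ?(ltW e1) //; lra.
Qed.

(** This expands the nonnegative form of [X] at [x - invmx X *m y]. *)
Lemma posdef_young q (X : 'M[R]_q) x y : posdefmx X ->
  2 * dot x y <= dot x (X *m x) + dot y (invmx X *m y).
Proof.
move=> X0; have Xu := posdef_unit X0; have [XT Xx] := (posdefmxP X).1 X0.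
pose z := x - invmx X *m y.
have z0 : 0 <= dot z (X *m z).
  have [->|z0] := eqVneq z 0; first by rewrite /dot mulmx0 mulmx0 mxE.
  by rewrite ltW // Xx.
move: z0; rewrite /z mulmxBr mulKVmx // dotDl !dotDr !dotNl !dotNr.
rewrite (dotC (invmx X *m y) (X *m x)) (dot_adj X x) XT mulKVmx //.
rewrite (dotC (invmx X *m y) y).
by lra.
Qed.

End QuadraticForms.

(** * Polynomial matrices, SOS matrices and quadratic modules *)

Section PolynomialMatrices.
Variable R : realType.
Implicit Types (p q : nat).

Lemma peval_pconst p q (X : 'M[R]_(p, q)) t : peval (pconst X) t = X.
Proof. by apply/matrixP => i j; rewrite !mxE /horner_eval hornerC. Qed.

Lemma pevalD p q (X Y : 'M[{poly R}]_(p, q)) t :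
  peval (X + Y) t = peval X t + peval Y t.
Proof. by rewrite /peval raddfD. Qed.

Lemma pevalN p q (X : 'M[{poly R}]_(p, q)) t : peval (- X) t = - peval X t.
Proof. by rewrite /peval raddfN. Qed.

Lemma pevalZ p q a (X : 'M[{poly R}]_(p, q)) t :
  peval (a *: X) t = a.[t] *: peval X t.
Proof. by apply/matrixP => i j; rewrite !mxE /horner_eval hornerM. Qed.

Lemma pevalM p q r (X : 'M[{poly R}]_(p, q)) (Y : 'M[{poly R}]_(q, r)) t :
  peval (X *m Y) t = peval X t *m peval Y t.
Proof. by rewrite /peval map_mxM. Qed.

Lemma peval_tr p q (X : 'M[{poly R}]_(p, q)) t : peval X^T t = (peval X t)^T.
Proof. by rewrite /peval map_trmx. Qed.

Lemma pevalE p q (X : 'M[{poly R}]_(p, q)) t i j : peval X t i j = (X i j).[t].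
Proof. by rewrite mxE. Qed.

Lemma pderivM p q r (X : 'M[{poly R}]_(p, q)) (Y : 'M[{poly R}]_(q, r)) :
  pderiv (X *m Y) = pderiv X *m Y + X *m pderiv Y.
Proof.
apply/matrixP => i j; rewrite !mxE raddf_sum -big_split /=.
by apply: eq_bigr => k _; rewrite derivM !mxE.
Qed.

Lemma pderiv_tr p q (X : 'M[{poly R}]_(p, q)) : pderiv X^T = (pderiv X)^T.
Proof. by rewrite /pderiv map_trmx. Qed.

Lemma pderiv_pconst p q (X : 'M[R]_(p, q)) : pderiv (pconst X) = 0.
Proof. by apply/matrixP => i j; rewrite !mxE derivC. Qed.

Lemma SOSmxD q (X Y : 'M[{poly R}]_q) : SOSmx X -> SOSmx Y -> SOSmx (X + Y).
Proof.
move=> [p [U ->]] [r [V ->]]; exists (p + r)%N, (col_mx U V).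
by rewrite tr_col_mx mul_row_col.
Qed.

Lemma SOSmx_gram p q (U : 'M[{poly R}]_(p, q)) : SOSmx (U^T *m U).
Proof. by exists p, U. Qed.

Lemma SOSmx_congr p q (T : 'M[{poly R}]_(p, q)) X :
  SOSmx X -> SOSmx (T^T *m X *m T).
Proof.
by move=> [r [U ->]]; exists r, (U *m T); rewrite trmx_mul !mulmxA.
Qed.

Lemma SOSmx0 q : SOSmx (0 : 'M[{poly R}]_q).
Proof. by exists 0%N, 0; rewrite mulmx0. Qed.

Lemma SOSmxM2 q s (X : 'M[{poly R}]_q) : SOSmx X -> SOSmx (s ^+ 2 *: X).
Proof.
move=> [p [U ->]]; exists p, (s *: U).
by rewrite [(s *: U)^T]linearZ -scalemxAl -scalemxAr scalerA.
Qed.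

Lemma SOSmxZ q c (X : 'M[{poly R}]_q) : 0 <= c -> SOSmx X -> SOSmx (c%:P *: X).
Proof.
by move=> c0 Xs; rewrite -(sqr_sqrtr c0) rmorphXn; apply: SOSmxM2.
Qed.

Lemma SOSmx_posdef q (X : 'M[R]_q) : posdefmx X -> SOSmx (pconst X).
Proof.
move=> /posdef_gram[p [L ->]]; exists p, (pconst L).
by rewrite /pconst map_mxM map_trmx.
Qed.

Lemma SOSmx_ge0 q (X : 'M[{poly R}]_q) t x : SOSmx X ->
  0 <= dot x (peval X t *m x).
Proof.
by move=> [p [U ->]]; rewrite pevalM peval_tr -mulmxA -dot_adj dot_ge0.
Qed.

Lemma SOSmx_sym q (X : 'M[{poly R}]_q) : SOSmx X -> X^T = X.
Proof. by move=> [p [U ->]]; rewrite trmx_mul trmxK. Qed.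

Lemma SOSmx_comp q (s : {poly R}) (X : 'M[{poly R}]_q) :
  SOSmx X -> SOSmx (map_mx (comp_poly s) X).
Proof.
move=> [p [U ->]]; exists p, (map_mx (comp_poly s) U).
by rewrite map_mxM map_trmx.
Qed.

(** The quadratic module generated by [h]: the witness [D] is the multiplier that plays the role of
    [Gamma] or [Delta] in the program. *)
Definition qmodule q (h : {poly R}) (F : 'M[{poly R}]_q) :=
  exists D, SOSmx D /\ SOSmx (F - h *: D).

Lemma qmoduleD q h (F G : 'M[{poly R}]_q) :
  qmodule h F -> qmodule h G -> qmodule h (F + G).
Proof.
move=> [D [Ds FD]] [E [Es GE]]; exists (D + E); split; first exact: SOSmxD.
by rewrite scalerDr opprD addrACA; apply: SOSmxD.
Qed.

Lemma qmodule0 q h : qmodule h (0 : 'M[{poly R}]_q).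
Proof.
exists 0; split; first exact: SOSmx0.
by rewrite scaler0 subr0; exact: SOSmx0.
Qed.

Lemma qmodule_sum q h (I : Type) (r : seq I) (F : I -> 'M[{poly R}]_q) :
  (forall i, qmodule h (F i)) -> qmodule h (\sum_(i <- r) F i).
Proof.
by move=> Fi; apply: big_ind => //; [exact: qmodule0|exact: qmoduleD].
Qed.

Lemma qmodule_ge0 q h (F : 'M[{poly R}]_q) t :
  qmodule h F -> 0 <= h.[t] -> lowbd 0 (peval F t).
Proof.
move=> [D [Ds FD]] h0 x; rewrite mul0r -(subrK (h *: D) F).
rewrite pevalD pevalZ mulmxDl dotDr -scalemxAl dotZr.
by rewrite addr_ge0 ?mulr_ge0 ?SOSmx_ge0.
Qed.

End PolynomialMatrices.

(** * Positivity certificates on intervals by Bernstein expansion *)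

Section Bernstein.
Variable R : realType.
Implicit Types (p q : nat).

Definition bern (d k : nat) : {poly R} :=
  'C(d, k)%:R * ('X^k * (1 - 'X) ^+ (d - k)).

(** Rearranging the product of binomials pulls ['C(d, j)] out of the sum and leaves the binomial
    expansion of [(1 - 'X + 'X) ^+ (d - j)]. The identity exhibits ['C(k, j) / 'C(d, j)] as the
    Bernstein coefficients of ['X^j] in degree [d]. *)
Lemma bern_moment d j : (j <= d)%N ->
  'C(d, j)%:R * 'X^j = \sum_(k < d.+1) 'C(k, j)%:R * bern d k.
Proof.
move=> jd.
rewrite -(big_mkord xpredT (fun k => 'C(k, j)%:R * bern d k)).
rewrite (big_cat_nat _ (n := j)) //=; last exact: leqW.
rewrite big1_seq ?add0r; last first.
  move=> k /andP[_]; rewrite mem_index_iota => /andP[_ kj].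
  by rewrite bin_small // mul0r.
have -> : \sum_(j <= k < d.+1) 'C(k, j)%:R * bern d k =
  'C(d, j)%:R * 'X^j * (1 - 'X + 'X) ^+ (d - j).
  rewrite -{1}(add0n j) big_addn subSn // big_mkord exprDn mulr_sumr.
  apply: eq_bigr => k _; rewrite /bern.
  have kd : (k + j <= d)%N by rewrite addnC -leq_subRL // -ltnS.
  rewrite [LHS]mulrA -natrM.
  have -> : ('C(k + j, j) * 'C(d, k + j) = 'C(d, j) * 'C(d - j, k))%N.
    have f0 : (0 < k`! * j`! * (d - j - k)`!)%N by rewrite !muln_gt0 !fact_gt0.
    apply/eqP; rewrite -(eqn_pmul2r f0); apply/eqP.
    have := bin_fact kd; have := bin_fact jd.
    have := bin_fact (leq_addl k j); rewrite addnK.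
    have kdj : (k <= d - j)%N by rewrite leq_subRL // addnC.
    have := bin_fact kdj; rewrite subnDAC -subnDA addnC subnDA => e1 e2 e3 e4.
    transitivity (d`!).
      by rewrite -e4 -e2; ring.
    by rewrite -e3 -e1; ring.
  rewrite natrM exprD -subnDA (addnC j) -[in RHS]mulr_natl.
  by ring.
by rewrite subrK expr1n mulr1.
Qed.

(* The ratio [k ^_ j / d ^_ j] is the [k]-th degree [d] Bernstein coefficient of
   ['X^j], while [(k / d) ^+ j] is the value of ['X^j] at the [k]-th node. *)
Lemma ffact_ratio_near d k j : (j <= d)%N -> (k <= d)%N -> (0 < d)%N ->
  `|(k ^_ j)%:R / (d ^_ j)%:R - (k%:R / d%:R) ^+ j| <= (j * j)%:R / d%:R :> R.
Proof.
move=> + kd d0; have d0' : 0 < d%:R :> R by rewrite ltr0n.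
elim: j => [|j IH] jd.
  by rewrite !ffactn0 expr0 divr1 subrr normr0 mul0r.
have {IH} := IH (ltnW jd).
set x : R := k%:R / d%:R; set y : R := (k ^_ j)%:R / _ => IH.
have x01 : 0 <= x <= 1.
  by rewrite divr_ge0 //= ler_pdivrMr // mul1r ler_nat.
pose s : R := (k - j)%:R / (d - j)%:R.
have dj0 : 0 < (d - j)%:R :> R by rewrite ltr0n subn_gt0.
have s0 : 0 <= s <= 1.
  by rewrite divr_ge0 //= ler_pdivrMr // mul1r ler_nat leq_sub2r.
have sx : 0 <= x - s <= j%:R / d%:R.
  rewrite /x /s; have [kj|jk] := leqP k j.
    have -> : (k - j = 0)%N by apply/eqP; rewrite subn_eq0.
    by rewrite mul0r subr0 divr_ge0 //= ler_pM2r ?invr_gt0 // ler_nat.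
  have -> : k%:R / d%:R - (k - j)%:R / (d - j)%:R =
     j%:R / d%:R * ((d - k)%:R / (d - j)%:R) :> R.
    rewrite !natrB //; try lia.
    by field; rewrite -natrB ?(ltnW jd) // !gt_eqF.
  rewrite mulr_ge0 ?divr_ge0 //= ler_piMr ?divr_ge0 // ler_pdivrMr // mul1r.
  by rewrite ler_nat leq_sub2l // ltnW.
rewrite !ffactnSr (natrM _ (k ^_ j)) (natrM _ (d ^_ j)) invfM mulrACA.
rewrite -/y -/s exprSr.
clearbody x y s.
(* The new factor [s] is within [j / d] of [x], so the error grows from [j * j / d] to at most
   [(j * j + j) / d]. *)
have -> : y * s - x ^+ j * x = (y - x ^+ j) * s - x ^+ j * (x - s) by ring.
apply: le_trans (ler_normB _ _) _; rewrite !normrM.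
have /andP[x0 x1] := x01; have /andP[s0' s1] := s0; have /andP[sx0 sx1] := sx.
rewrite (ger0_norm s0') (ger0_norm sx0) (ger0_norm (exprn_ge0 _ x0)).
apply: (@le_trans _ _ ((j * j)%:R / d%:R * 1 + 1 * (j%:R / d%:R))).
  by rewrite lerD // ler_pM // ?exprn_ge0 // exprn_ile1.
rewrite mulr1 mul1r -mulrDl -natrD ler_pM2r ?invr_gt0 // ler_nat; lia.
Qed.

Lemma bin_ratio d k j : (j <= d)%N ->
  'C(k, j)%:R / 'C(d, j)%:R = (k ^_ j)%:R / (d ^_ j)%:R :> R.
Proof.
move=> jd; rewrite -!bin_ffact !natrM.
have j0 : (j`!)%:R != 0 :> R by rewrite pnatr_eq0 -lt0n fact_gt0.
have d0 : 'C(d, j)%:R != 0 :> R by rewrite pnatr_eq0 -lt0n bin_gt0.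
by field; rewrite j0.
Qed.

(** The exponents [k] and [r.*2 - k] have the same parity. If both are even the product is a square;
    if both are odd, one factor ['X * (1 - 'X)] comes out and leaves a square. *)
Lemma bern_qmodule q r k (B : 'M[R]_q) : (k <= r.*2)%N -> posdefmx B ->
  qmodule ('X * (1 - 'X)) (bern r.*2 k *: pconst B).
Proof.
move=> kr /SOSmx_posdef Bs.
have := SOSmxZ (ler0n R 'C(r.*2, k)) Bs.
rewrite polyC_natr => {}Bs.
rewrite /bern [_%:R * _]mulrC -scalerA; set D := _ *: pconst B in Bs *.
clearbody D.
have [ok|ek] := boolP (odd k); last first.
  exists 0; split; first exact: SOSmx0.
  rewrite scaler0 subr0.
  have -> : 'X^k * (1 - 'X) ^+ (r.*2 - k) =
    ('X^(k./2) * (1 - 'X) ^+ (r - k./2)) ^+ 2 :> {poly R}.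
    rewrite exprMn -!exprM; congr ('X^_ * _ ^+ _); lia.
  exact: SOSmxM2.
exists (('X^(k./2) * (1 - 'X) ^+ (r - k./2 - 1)) ^+ 2 *: D); split.
  exact: SOSmxM2.
rewrite scalerA.
have -> : 'X^k * (1 - 'X) ^+ (r.*2 - k) =
  'X * (1 - 'X) * ('X^(k./2) * (1 - 'X) ^+ (r - k./2 - 1)) ^+ 2 :> {poly R}.
  rewrite exprMn -!exprM mulrACA -!exprS; congr ('X^_ * _ ^+ _); lia.
by rewrite subrr; exact: SOSmx0.
Qed.


(** The Bernstein coefficients of [F] in degree [d] approximate its values at the nodes [k / d] with
    an error of order [1 / d]. For large [d] they inherit positive definiteness, and the Bernstein
    expansion itself is the certificate. *)
Lemma qmodule_itv01 q c (F : 'M[{poly R}]_q) : 0 < c -> F^T = F ->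
  (forall t, 0 <= t <= 1 -> lowbd c (peval F t)) -> qmodule ('X * (1 - 'X)) F.
Proof.
move=> c0 FT Fc.
pose e := (\max_i \max_j size (F i j))%N.
pose Fc_ l : 'M[R]_q := map_mx (coefp l) F.
have sizeF i j : (size (F i j) <= e)%N.
  by rewrite /e (leq_trans _ (leq_bigmax i)) // (leq_bigmax j).
have FE : F = \sum_(l < e) 'X^l *: pconst (Fc_ l).
  apply/matrixP => i j; rewrite summxE -[LHS]coefK poly_def.
  rewrite (big_ord_widen _ (fun l => (F i j)`_l *: 'X^l) (sizeF i j)).
  rewrite big_mkcond; apply: eq_bigr => l _; rewrite !mxE -mul_polyC mulrC.
  by case: ltnP => // sl; rewrite /= nth_default // mulr0.
pose M : R := \sum_(l < e) \sum_i \sum_j `|Fc_ l i j|.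
have M0 : 0 <= M.
  by apply: sumr_ge0 => ? _; apply: sumr_ge0 => ? _; apply: sumr_ge0.
have FM l i j : (l < e)%N -> `|Fc_ l i j| <= M.
  move=> le; rewrite /M (bigD1 (Ordinal le)) //= (bigD1 i) //= (bigD1 j) //=.
  rewrite -!addrA lerDl !addr_ge0 ?sumr_ge0 // => ? _; rewrite sumr_ge0 // => ? _.
  by apply: sumr_ge0.
(* At a node, each of the [e] monomials contributes an entrywise error of at most [e * e / d * M];
   the last factor [q] is the price of [lowbd_near]. The total loss of margin is [W / d]. *)
pose W : R := (e * e)%:R * M * e%:R * q%:R.
have W0 : 0 <= W by rewrite !mulr_ge0.
(* Large enough for [W / d < c], and for [e <= d], so that [bern_moment] applies to every monomial
   of [F]. *)
pose r := (Num.truncn (W / c) + e).+1.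
pose d := r.*2.
have ed : (e <= d)%N by rewrite /d /r; lia.
have d0 : (0 < d)%N by rewrite /d /r; lia.
have d0' : 0 < d%:R :> R by rewrite ltr0n.
have Wd : W / d%:R < c.
  rewrite ltr_pdivrMr // mulrC -ltr_pdivrMr //.
  apply: lt_le_trans (truncnS_gt _) _.
  by rewrite ler_nat /d /r; move: (Num.truncn _) => t; lia.
(* By [bern_moment], [rho k l] is the [k]-th Bernstein coefficient of ['X^l], hence [B k] is that of
   [F]. *)
pose rho k l : R := 'C(k, l)%:R / 'C(d, l)%:R.
pose B k := \sum_(l < e) rho k l *: Fc_ l.
have BT k : (B k)^T = B k.
  rewrite /B linear_sum; apply: eq_bigr => l _; rewrite linearZ /=.
  by rewrite /Fc_ map_trmx FT.
have B0 k : (k <= d)%N -> posdefmx (B k).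
  move=> kd; apply: (@lowbd_posdef _ _ (c - W / d%:R)) => //.
    by rewrite subr_gt0.
  have kd01 : 0 <= (k%:R / d%:R : R) <= 1.
    by rewrite divr_ge0 //= ler_pdivrMr // mul1r ler_nat.
  have -> : W / d%:R = ((e * e)%:R / d%:R * M * e%:R) * q%:R.
    by rewrite /W; field; rewrite gt_eqF.
  apply: lowbd_near (Fc _ kd01) _ => i j.
  rewrite FE /B pevalE !summxE horner_sum -sumrB.
  apply: le_trans (ler_norm_sum _ _ _) _.
  apply: (@le_trans _ _ (\sum_(l < e) (e * e)%:R / d%:R * M)); last first.
    by rewrite sumr_const card_ord mulr_natr lexx.
  apply: ler_sum => l _.
  rewrite mxE [in X in _ - X]mxE [pconst _ _ _]mxE.
  rewrite hornerM hornerXn hornerC -mulrBl normrM.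
  apply: ler_pM => //; last exact: FM.
  have ld : (l <= d)%N by rewrite (leq_trans _ ed) // ltnW.
  rewrite /rho bin_ratio //; apply: le_trans (ffact_ratio_near ld kd d0) _.
  by rewrite ler_pM2r ?invr_gt0 // ler_nat leq_mul // ltnW.
suff -> : F = \sum_(k < d.+1) bern d k *: pconst (B k).
  apply: qmodule_sum => k; apply: bern_qmodule; first by rewrite -ltnS.
  by apply: B0; rewrite -ltnS.
transitivity (\sum_(k < d.+1) \sum_(l < e)
    (bern d k * (rho k l)%:P) *: pconst (Fc_ l)); last first.
  apply: eq_bigr => k _; rewrite /B /pconst raddf_sum scaler_sumr.
  apply: eq_bigr => l _; rewrite -scalerA; congr (_ *: _).
  by apply/matrixP => i j; rewrite !mxE [RHS]polyCM.
rewrite exchange_big /= [LHS]FE; apply: eq_bigr => l _.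
rewrite -scaler_suml; congr (_ *: _).
have ld : (l <= d)%N by rewrite (leq_trans _ ed) // ltnW.
have dl0 : 'C(d, l)%:R != 0 :> R by rewrite pnatr_eq0 -lt0n bin_gt0.
transitivity (('C(d, l)%:R^-1)%:P * ('C(d, l)%:R * 'X^l) : {poly R}).
  by rewrite -polyC_natr mulrA -polyCM mulVf // mul1r.
rewrite bern_moment // mulr_sumr; apply: eq_bigr => k _.
by rewrite /rho polyCM polyC_natr; ring.
Qed.

(* Here [hpoly a a = - ('X - a) ^+ 2]. Writing [F = F(a) + ('X - a) H], the
   cross term is absorbed by half the square of
   [sqrt c + ('X - a) H / sqrt c]. *)
Lemma qmodule_point q c (F : 'M[{poly R}]_q) a : 0 < c -> F^T = F ->
  lowbd c (peval F a) -> qmodule (hpoly a a) F.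
Proof.
move=> c0 FT Fc.
pose H := map_mx (fun p : {poly R} => (p - p.[a]%:P) %/ ('X - a%:P)) F.
have HT : H^T = H by rewrite /H map_trmx FT.
have FE : F = pconst (peval F a) + ('X - a%:P) *: H.
  apply/matrixP => i j; rewrite !mxE /horner_eval mulrC divpK.
    by rewrite addrC subrK.
  by rewrite dvdp_XsubCl /root !hornerE subrr.
pose s : {poly R} := 'X - a%:P.
pose r := Num.sqrt c.
have r0 : r != 0 by rewrite sqrtr_eq0 -ltNge.
have rc : r ^+ 2 = c by rewrite sqr_sqrtr // ltW.
exists ((2^-1)%:P *: ((r^-1)%:P ^+ 2 *: (H^T *m H))); split.
  by apply: SOSmxZ; [rewrite invr_ge0|apply: SOSmxM2; apply: SOSmx_gram].
pose T := r%:P%:M + ((r^-1)%:P * s) *: H.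
have TT : T^T = T by rewrite /T linearD /= tr_scalar_mx linearZ /= HT.
have -> : F - hpoly a a *: ((2^-1)%:P *: ((r^-1)%:P ^+ 2 *: (H^T *m H))) =
   pconst (peval F a - (c / 2)%:M) + (2^-1)%:P *: (T^T *m T).
  rewrite TT HT {1}FE /T -/s.
  have -> : (r%:P%:M + (r^-1%:P * s) *: H) *m (r%:P%:M + (r^-1%:P * s) *: H)
    = (r%:P ^+ 2)%:M + (2%:R * s) *: H + (r^-1%:P * s) ^+ 2 *: (H *m H).
    rewrite mulmxDl !mulmxDr -scalar_mxM !mul_scalar_mx !mul_mx_scalar.
    rewrite -scalemxAl -scalemxAr !scalerA -expr2 -!addrA; congr (_ + _).
    rewrite addrA -scalerDl; congr (_ *: _ + _).
    have rr : r%:P * r^-1%:P = 1 :> {poly R} by rewrite -polyCM divff.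
    by rewrite mulrA rr mul1r mulr_natl mulr2n.
  have -> : pconst (peval F a - (c / 2)%:M) =
      pconst (peval F a) - ((c / 2)%:P)%:M.
    by rewrite /pconst raddfB /= map_scalar_mx.
  have r2c : r%:P ^+ 2 = c%:P by rewrite -polyC_exp rc.
  rewrite !scalerDr scale_scalar_mx r2c.
  rewrite -polyCM (mulrC _ c).
  rewrite !addrA subrK !scalerA; congr (_ + _ *: _ + _).
    by rewrite mulrA -polyC_natr -polyCM mulVf ?mul1r // pnatr_eq0.
  rewrite -scaleNr; congr (_ *: _); rewrite /hpoly -/s; rewrite /s; ring.
apply: SOSmxD; last by apply: SOSmxZ; [rewrite invr_ge0|apply: SOSmx_gram].
apply: SOSmx_posdef; apply: (@lowbd_posdef _ _ (c - c / 2)).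
- by rewrite linearB /= tr_scalar_mx -peval_tr FT.
- by rewrite {1}(splitr c) addrK divr_gt0.
- by move=> x; rewrite mulmxBl dotDr dotNr dot_scalar mulrBl lerB.
Qed.

(** A degenerate interval is the point case; otherwise the affine substitution [u] transports the
    problem to the unit interval and [v] transports the certificate back. *)
Lemma qmodule_itv q c (F : 'M[{poly R}]_q) a b : 0 < c -> F^T = F -> a <= b ->
  (forall t, a <= t <= b -> lowbd c (peval F t)) -> qmodule (hpoly a b) F.
Proof.
move=> c0 FT; rewrite le_eqVlt => /predU1P[<- Fc|ab Fc].
  by apply: qmodule_point c0 FT _; apply: Fc; rewrite lexx.
have ba : 0 < b - a by rewrite subr_gt0.
have ba0 : b - a != 0 by rewrite gt_eqF.
pose u : {poly R} := a%:P + (b - a) *: 'X.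
pose v : {poly R} := (b - a)^-1 *: ('X - a%:P).
have uv : u \Po v = 'X.
  rewrite /u comp_polyD comp_polyC comp_polyZ comp_polyX /v scalerA divff //.
  by rewrite scale1r addrC subrK.
pose G := map_mx (comp_poly u) F.
have FG : F = map_mx (comp_poly v) G.
  by apply/matrixP => i j; rewrite !mxE /= -comp_polyA uv comp_polyXr.
have [||D [Ds GD]] := @qmodule_itv01 q c G c0.
- by rewrite /G map_trmx FT.
- move=> t /andP[t0 t1].
  have -> : peval G t = peval F (a + (b - a) * t).
    by apply/matrixP => i j; rewrite !mxE /horner_eval horner_comp /u !hornerE.
  by apply: Fc; apply/andP; split; nra.
(* The factor appears because [v * (1 - v)] equals [hpoly a b] divided by the square of [b - a]. *)
exists ((((b - a)^-1)%:P ^+ 2) *: map_mx (comp_poly v) D); split.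
  exact/SOSmxM2/SOSmx_comp.
have -> : F - hpoly a b *: (((b - a)^-1)%:P ^+ 2 *: map_mx (comp_poly v) D) =
  map_mx (comp_poly v) (G - ('X * (1 - 'X)) *: D).
  rewrite raddfB /= -FG; congr (_ - _).
  apply/matrixP => i j; rewrite !mxE /= !comp_polyM comp_polyB comp_polyX.
  rewrite mulrA; congr (_ * _); rewrite comp_polyC /v /hpoly.
  have -> : 1%:P = ((b - a)^-1)%:P * (b - a)%:P by rewrite -polyCM mulVf.
  by rewrite -mul_polyC polyCB; ring.
exact: SOSmx_comp.
Qed.

End Bernstein.

(** * Uniform limits of matrix functions on [[0, T]] *)

Section UniformLimits.
Local Open Scope classical_set_scope.
Variables (R : realType) (T : R).
Implicit Types (p q r : nat).

Definition mxbnd p q (G : R -> 'M[R]_(p, q)) :=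
  exists C, forall t, 0 <= t <= T -> forall i j, `|G t i j| <= C.

(** Boundedness of the limit is bundled in because the convergence of products relies on it. *)
Definition ucvg p q (F : nat -> R -> 'M[R]_(p, q)) (G : R -> 'M[R]_(p, q)) :=
  mxbnd G /\ forall e, 0 < e -> exists K, forall k, (K <= k)%N ->
    forall t, 0 <= t <= T -> forall i j, `|F k t i j - G t i j| <= e.

Lemma mxbnd_ge0 p q (G : R -> 'M[R]_(p, q)) : mxbnd G ->
  exists2 C, 0 <= C & forall t, 0 <= t <= T -> forall i j, `|G t i j| <= C.
Proof.
move=> [C GC]; exists (Num.max 0 C); first by rewrite le_max lexx.
by move=> t t0 i j; rewrite (le_trans (GC t t0 i j)) // le_max lexx orbT.
Qed.

Lemma mxbnd_tr p q (G : R -> 'M[R]_(p, q)) :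
  mxbnd G -> mxbnd (fun t => (G t)^T).
Proof. by move=> [C GC]; exists C => t t0 i j; rewrite mxE GC. Qed.

Lemma mxbndM p q r (G : R -> 'M[R]_(p, q)) (H : R -> 'M[R]_(q, r)) :
  mxbnd G -> mxbnd H -> mxbnd (fun t => G t *m H t).
Proof.
move=> /mxbnd_ge0[C C0 GC] /mxbnd_ge0[D D0 HD]; exists (C * D * q%:R).
move=> t t0 i j; rewrite mxE; apply: le_trans (ler_norm_sum _ _ _) _.
apply: (@le_trans _ _ (\sum_(k < q) C * D)).
  by apply: ler_sum => k _; rewrite normrM ler_pM ?GC ?HD.
by rewrite sumr_const card_ord mulr_natr.
Qed.

Lemma mxbnd_cst p q (X : 'M[R]_(p, q)) : mxbnd (fun=> X).
Proof.
exists (\sum_i \sum_j `|X i j|) => t _ i j.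
rewrite (bigD1 i) //= (bigD1 j) //= -addrA lerDl.
by rewrite addr_ge0 ?sumr_ge0 // => *; rewrite sumr_ge0.
Qed.

Lemma mxbnd_peval p q (P : 'M[{poly R}]_(p, q)) : mxbnd (peval P).
Proof.
pose u i j := sval (poly_itv_bound (P i j) 0 T).
exists (\sum_i \sum_j `|u i j|) => t t0 i j; rewrite pevalE.
apply: le_trans (svalP (poly_itv_bound (P i j) 0 T) t t0) _; rewrite -/(u i j).
apply: le_trans (ler_norm _) _.
rewrite (bigD1 i) //= (bigD1 j) //= -addrA lerDl.
by rewrite addr_ge0 ?sumr_ge0 // => *; rewrite sumr_ge0.
Qed.

Lemma mxbnd_dot p q (G : R -> 'M[R]_(p, q)) : mxbnd G ->
  exists2 C, 0 < C & forall t, 0 <= t <= T -> forall x,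
    dot (G t *m x) (G t *m x) <= C * dot x x.
Proof.
move=> Gb; have /mxbnd_ge0[C C0 GC] := mxbndM (mxbnd_tr Gb) Gb.
(* The [+ 1] makes the constant strictly positive, as it later serves as a divisor. *)
exists (C * q%:R + 1); first by rewrite ltr_wpDl // mulr_ge0.
move=> t t0 x; rewrite dot_adj mulmxA.
apply: le_trans (ler_norm _) _; apply: le_trans (dot_mx_le _ (GC t t0)) _.
by rewrite ler_wpM2r ?dot_ge0 // lerDl.
Qed.

Lemma ucvg_cst p q (G : R -> 'M[R]_(p, q)) : mxbnd G -> ucvg (fun=> G) G.
Proof.
move=> Gb; split=> // e e0; exists 0%N => k _ t _ i j.
by rewrite subrr normr0 ltW.
Qed.

Lemma ucvg_tr p q F (G : R -> 'M[R]_(p, q)) :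
  ucvg F G -> ucvg (fun k t => (F k t)^T) (fun t => (G t)^T).
Proof.
move=> [Gb FG]; split; first exact: mxbnd_tr.
move=> e /FG[K FK]; exists K => k Kk t t0 i j; rewrite !mxE; exact: FK.
Qed.

Lemma ucvg_shift p q F (G : R -> 'M[R]_(p, q)) :
  ucvg F G -> ucvg (fun k => F k.+1) G.
Proof.
move=> [Gb FG]; split=> // e /FG[K FK].
by exists K => k Kk; apply: FK; exact: leqW.
Qed.

Lemma ucvg_ext p q F F' (G G' : R -> 'M[R]_(p, q)) :
  (forall k t, F k t = F' k t) -> (forall t, 0 <= t <= T -> G t = G' t) ->
  ucvg F G -> ucvg F' G'.
Proof.
move=> FF GG [[C GC] FG]; split.
  by exists C => t t0; rewrite -GG //; exact: GC.
move=> e /FG[K FK]; exists K => k Kk t t0; rewrite -FF -GG //; exact: FK.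
Qed.

Lemma ucvgD p q F1 F2 (G1 G2 : R -> 'M[R]_(p, q)) : ucvg F1 G1 -> ucvg F2 G2 ->
  ucvg (fun k t => F1 k t + F2 k t) (fun t => G1 t + G2 t).
Proof.
move=> [[C1 GC1] FG1] [[C2 GC2] FG2]; split.
  exists (C1 + C2) => t t0 i j; rewrite mxE.
  by rewrite (le_trans (ler_normD _ _)) // lerD ?GC1 ?GC2.
move=> e e0; have e2 : 0 < e / 2 by rewrite divr_gt0.
have [K1 FK1] := FG1 _ e2; have [K2 FK2] := FG2 _ e2.
exists (maxn K1 K2) => k; rewrite geq_max => /andP[k1 k2] t t0 i j.
rewrite !mxE opprD addrACA (le_trans (ler_normD _ _)) // (splitr e).
by rewrite lerD ?FK1 ?FK2.
Qed.

Lemma ucvgM p q r F1 F2 (G1 : R -> 'M[R]_(p, q)) (G2 : R -> 'M[R]_(q, r)) :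
  ucvg F1 G1 -> ucvg F2 G2 ->
  ucvg (fun k t => F1 k t *m F2 k t) (fun t => G1 t *m G2 t).
Proof.
move=> [G1b FG1] [G2b FG2]; split; first exact: mxbndM.
have [C1 C10 GC1] := mxbnd_ge0 G1b; have [C2 C20 GC2] := mxbnd_ge0 G2b.
(* With both errors at most [d <= 1], each of the [q] summands is off by at most
   [d * (C1 + C2 + 1)]; using [1 + q] keeps [M] positive when [q] is 0. *)
move=> e e0; pose M := (C1 + C2 + 1) * (1 + q%:R).
have M0 : 0 < M by rewrite mulr_gt0 // ltr_wpDl // ?addr_ge0 // ltr_pwDl.
pose d := Num.min 1 (e / M).
have d0 : 0 < d by rewrite lt_min ltr01 divr_gt0.
have [K1 FK1] := FG1 _ d0; have [K2 FK2] := FG2 _ d0.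
exists (maxn K1 K2) => k; rewrite geq_max => /andP[k1 k2] t t0 i j.
rewrite !mxE -sumrB; apply: le_trans (ler_norm_sum _ _ _) _.
apply: (@le_trans _ _ (\sum_(l < q) d * (C1 + C2 + 1))); last first.
  rewrite sumr_const card_ord -mulr_natr.
  apply: (@le_trans _ _ (d * M)).
    by rewrite -mulrA /M ler_wpM2l ?(ltW d0) // ler_wpM2l ?lerDr ?addr_ge0.
  by rewrite -ler_pdivlMr // /d ge_min lexx orbT.
apply: ler_sum => l _.
have d1 : d <= 1 by rewrite /d ge_min lexx.
move: (FK1 _ k1 _ t0 i l) (FK2 _ k2 _ t0 l j) (GC1 _ t0 i l) (GC2 _ t0 l j).
move: (F1 k t i l) (G1 t i l) (F2 k t l j) (G2 t l j) => a b c f ab cf bC fC.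
have -> : a * c - b * f = (a - b) * (c - f) + (a - b) * f + b * (c - f) by ring.
apply: le_trans (ler_normD _ _) _.
apply: le_trans (lerD (ler_normD _ _) (lexx _)) _.
rewrite !normrM.
have H1 : `|a - b| * `|c - f| <= d * 1.
  by rewrite ler_pM // (le_trans cf).
have H2 : `|a - b| * `|f| <= d * C2 by rewrite ler_pM.
have H3 : `|b| * `|c - f| <= C1 * d by rewrite ler_pM.
by lra.
Qed.

Lemma ucvgN p q F (G : R -> 'M[R]_(p, q)) :
  ucvg F G -> ucvg (fun k t => - F k t) (fun t => - G t).
Proof.
move=> [[C GC] FG]; split.
  by exists C => t t0 i j; rewrite mxE normrN GC.
move=> e /FG[K FK]; exists K => k Kk t t0 i j.
by rewrite !mxE -opprD normrN; apply: FK.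
Qed.

Lemma ucvg_pt p q F (G : R -> 'M[R]_(p, q)) t i j : 0 <= t <= T -> ucvg F G ->
  (fun k => F k t i j) @ \oo --> G t i j.
Proof.
move=> t0 [_ FG]; apply/cvgrPdist_le => e /FG[K FK].
by exists K => // k Kk; rewrite distrC; apply: FK.
Qed.

(** Identities between exponentials are derived from this, by letting one polynomial sequence
    converge to both sides. *)
Lemma ucvg_unique p q F (G G' : R -> 'M[R]_(p, q)) t : 0 <= t <= T ->
  ucvg F G -> ucvg F G' -> G t = G' t.
Proof.
move=> t0 FG FG'; apply/matrixP => i j.
exact: (cvg_unique (@Rhausdorff R) (ucvg_pt t0 FG) (ucvg_pt t0 FG')).
Qed.

Lemma ucvg_lowbd q F (G : R -> 'M[R]_q) (D : R -> Prop) c :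
  ucvg F G -> (forall t, D t -> 0 <= t <= T) ->
  0 < c -> (forall t, D t -> lowbd c (G t)) ->
  exists K, forall k, (K <= k)%N -> forall t, D t -> lowbd (c / 2) (F k t).
Proof.
move=> [_ FG] DT c0 Gc.
have q1 : 0 < 1 + q%:R :> R by rewrite ltr_pwDl.
have [|K FK] := FG (c / 2 / (1 + q%:R)).
  by rewrite !divr_gt0.
exists K => k Kk t Dt.
apply: lowbd_le (lowbd_near (Gc t Dt) (FK k Kk t (DT t Dt))).
suff : c / 2 / (1 + q%:R) * q%:R <= c / 2 by move: (_ * q%:R) => u; lra.
by rewrite mulrAC ler_pdivrMr // ler_pM2l ?divr_gt0 // lerDr.
Qed.

(** The mean value theorem is applied to the polynomial approximants, so the limit [G] itself is
    never differentiated. A derivative error of [e / t] costs at most [e] over the length [t]. *)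
Lemma ucvg_nonincr p q (P : nat -> 'M[{poly R}]_(p, q)) G H i j t :
  0 <= t <= T -> ucvg (fun k => peval (P k)) G ->
  ucvg (fun k => peval (pderiv (P k))) H ->
  (forall s, 0 <= s <= T -> H s i j <= 0) -> G t i j <= G 0 i j.
Proof.
move=> /andP[t0 tT] PG PH H0.
have [<-//|tn0] := eqVneq 0 t.
have {tn0}t0' : 0 < t by rewrite lt_neqAle tn0.
have T0 : 0 <= T := le_trans t0 tT.
apply/ler_addgt0Pr => e e0.
have et : 0 < e / t by rewrite divr_gt0.
have [_ /(_ _ et)[K PK]] := PH.
have c0 : (fun k => peval (P k) 0 i j + e) @ \oo --> G 0 i j + e.
  by apply: cvgD; [apply: ucvg_pt PG; rewrite lexx|exact: cvg_cst].
have ct : (fun k => peval (P k) t i j) @ \oo --> G t i j.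
  by apply: ucvg_pt PG; rewrite t0.
apply: ler_cvg_to ct c0 _; exists K => // k /= Kk.
have [s] := poly_mvt (P k i j) t0'; rewrite in_itv /= => /andP[s0 st] Es.
have sT : 0 <= s <= T by rewrite ltW //= (le_trans (ltW st)).
rewrite !pevalE -lerBlDl Es subr0 -ler_pdivlMr //.
have := PK k Kk s sT i j; rewrite !mxE /horner_eval => /ler_normlP[_].
by have := H0 s sT; lra.
Qed.

(** Each point has its own margin, which persists nearby; compactness of the segment makes it
    uniform. The continuity used is that of a single polynomial approximant close to [G]. *)
Lemma ucvg_posdef q (P : nat -> 'M[{poly R}]_q) G a b :
  0 <= a -> b <= T -> ucvg (fun k => peval (P k)) G ->
  (forall t, a <= t <= b -> posdefmx (G t)) ->
  exists2 c, 0 < c & forall t, a <= t <= b -> lowbd c (G t).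
Proof.
move=> a0 bT [_ PG] Gpos.
have abT t : a <= t <= b -> 0 <= t <= T.
  by move=> /andP[at_ tb]; rewrite (le_trans a0) // (le_trans tb).
have /compact_near_coveringP := @segment_compact R a b.
(* The margin [c] runs through the right neighbourhoods of 0: local statements valid for all small
   [c] then combine into one valid on the whole segment. *)
move=> /(_ R 0^'+ (fun c t => a <= t <= b -> lowbd c (G t)) _) H.
suff near0 : \forall c \near 0^'+,
    `[a, b] `<=` (fun t => a <= t <= b -> lowbd c (G t)).
  have [c [c0 Hc]] := @filter_ex _ _ (at_right_proper_filter (0 : R)) _
    (filterI (nbhs_right_gt (0 : R)) near0).
  by exists c => // t tab; apply: Hc => //=; rewrite in_itv.
apply: H => t0 /=; rewrite in_itv /= => t0ab.
have [c0 c00 Gc0] := posdef_lowbd (Gpos t0 t0ab).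
have q1 : 0 < 1 + q%:R :> R by rewrite ltr_pwDl.
(* Going from [G t0] to [G t] through the approximant costs three errors [e]; the constant 6 turns
   the total loss into at most half of [c0]. *)
pose e := c0 / (6 * (1 + q%:R)).
have e0 : 0 < e by rewrite divr_gt0 // mulr_gt0.
have [K /(_ K (leqnn K)) PK] := PG e e0.
have e3 : c0 / 2 <= c0 - 3 * e * q%:R.
  suff : 3 * e * q%:R <= c0 / 2 by lra.
  have -> : 3 * e * q%:R = c0 / 2 * (q%:R / (1 + q%:R)).
    rewrite /e.
    by field; rewrite gt_eqF.
  by rewrite ler_piMr ?divr_ge0 ?(ltW c00) // ler_pdivrMr // mul1r lerDr.
pose g i j t := `|peval (P K) t i j - peval (P K) t0 i j| <= e.
have near_t : \forall t \near t0, forall i j, g i j t.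
  apply: (@filter_forall _ 'I_q (fun i t => forall j, g i j t) (nbhs t0) _) => i.
  apply: (@filter_forall _ 'I_q (fun j t => is_true (g i j t)) (nbhs t0) _) => j.
  rewrite /g.
  have /cvgrPdist_le/(_ e e0) := @continuous_horner R (P K i j) t0.
  by apply: filterS => t; rewrite !pevalE distrC.
have near_c : \forall c \near 0^'+, c <= c0 / 2.
  have c2 : 0 < c0 / 2 by rewrite divr_gt0.
  exact: (nbhs_right_le c2).
exists ([set t | forall i j, g i j t], [set c | c <= c0 / 2]) => //=
  -[t c] /= [Pt cc] tab.
apply: lowbd_le (le_trans cc e3) (lowbd_near Gc0 _) => i j.
have := Pt i j; have := PK t (abT _ tab) i j; have := PK t0 (abT _ t0ab) i j.
move=> /ler_normlP[h1 h2] /ler_normlP[h3 h4] /ler_normlP[h5 h6].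
by apply/ler_normlP; split; lra.
Qed.

End UniformLimits.

(** * The matrix exponential as a uniform limit of polynomial matrices *)

Section Exponential.
Local Open Scope classical_set_scope.
Variable R : realType.
Implicit Types (p q : nat).

(** Weierstrass test with its rate: the tail bound depends on [a] alone, which later gives
    uniformity in [t]. *)
Lemma series_dominated (u a : nat -> R) : (forall l, `|u l| <= a l) ->
  cvgn (series a) -> exists L, series u @ \oo --> L /\
    forall k, `|L - series u k| <= limn (series a) - series a k.
Proof.
move=> ua ca.
have cu : cvgn (series u).
  apply: normed_cvg; apply: series_le_cvg ca => // n; rewrite /=.
    exact: normr_ge0.
  exact: le_trans (ua n).
exists (limn (series u)); split=> // k.
have c1 : (fun l => `|series u l - series u k|) @ \oo -->
    `|limn (series u) - series u k|.
  by apply: cvg_norm; apply: cvgB => //; exact: cvg_cst.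
have c2 : (fun l => series a l - series a k) @ \oo -->
    limn (series a) - series a k.
  by apply: cvgB => //; exact: cvg_cst.
apply: ler_cvg_to c1 c2 _; exists k => // l /= kl.
have sE v : series v l - series v k = \sum_(k <= i < l) v i :> R.
  by rewrite -sub_series_geq.
rewrite !sE; apply: le_trans (ler_norm_sum _ _ _) _.
by apply: ler_sum => i _.
Qed.

Lemma cvg_mx p q (F : nat -> 'M[R]_(p, q)) (L : 'M[R]_(p, q)) :
  (forall i j, (fun k => F k i j) @ \oo --> L i j) -> F @ \oo --> L.
Proof.
move=> FL; apply/cvgrPdist_le => /= e e0; near=> k.
rewrite /Num.Def.normr/= mx_normrE (bigmax_le _ (ltW e0))//= => i _.
rewrite !mxE/=; move: i; near: k.
apply: (@filter_forall nat ('I_p * 'I_q)%type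
  (fun i k => is_true (`|L i.1 i.2 - F k i.1 i.2| <= e)) \oo _) => i.
exact: (cvgrPdist_le _ _).1 (FL i.1 i.2) e e0.
Unshelve. all: by end_near. Qed.

(** The first [k] terms of the series of the exponential of [t *: X], as a polynomial matrix in
    [t]. *)
Definition expp q (X : 'M[R]_q) (k : nat) : 'M[{poly R}]_q :=
  \sum_(l < k) (l`!%:R^-1 *: 'X^l : {poly R}) *: pconst (X ^+ l).

Lemma exprZmx q t (X : 'M[R]_q) l : (t *: X) ^+ l = t ^+ l *: X ^+ l.
Proof.
elim: l => [|l IH]; first by rewrite !expr0 scale1r.
by rewrite !exprS IH -[_ * _]/(_ *m _) -scalemxAl -scalemxAr scalerA.
Qed.

Lemma peval_sum p q I (r : seq I) (F : I -> 'M[{poly R}]_(p, q)) t :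
  peval (\sum_(i <- r) F i) t = \sum_(i <- r) peval (F i) t.
Proof. by rewrite /peval raddf_sum. Qed.

Lemma peval_expp q (X : 'M[R]_q) k t :
  peval (expp X k) t = series (fun l => l`!%:R^-1 *: (t *: X) ^+ l) k.
Proof.
rewrite /series /= big_mkord peval_sum; apply: eq_bigr => l _.
by rewrite pevalZ peval_pconst !hornerE exprZmx scalerA.
Qed.

Lemma pderiv_expp q (X : 'M[R]_q) k :
  pderiv (expp X k.+1) = pconst X *m expp X k.
Proof.
rewrite /expp [in LHS]/pderiv raddf_sum big_ord_recl /= -/(pderiv _).
have -> : pderiv ((0`!%:R^-1 *: 'X^0) *: pconst (X ^+ 0)) = 0.
  apply/matrixP => i j; rewrite !mxE fact0 invr1 scale1r mul1r.
  by rewrite derivC.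
rewrite add0r mulmx_sumr; apply: eq_bigr => l _.
rewrite /bump leq0n add1n -scalemxAr /pconst -map_mxM -[X *m _]exprS.
apply/matrixP => i j; rewrite [LHS]mxE [in LHS]mxE [in RHS]mxE.
rewrite derivM [_ _ i j]mxE derivC mulr0 addr0; congr (_ * _).
rewrite derivZ derivXn /= factS natrM invfM -(scaler_nat _ ('X^l)) scalerA.
by rewrite mulrAC mulVf ?mul1r // pnatr_eq0.
Qed.

Lemma expp_tr q (X : 'M[R]_q) k : expp X^T k = (expp X k)^T.
Proof.
rewrite /expp linear_sum; apply: eq_bigr => l _.
rewrite linearZ /= /pconst map_trmx; congr (_ *: map_mx _ _).
elim: (nat_of_ord l) => [|m IH]; first by rewrite !expr0 trmx1.
by rewrite exprSr exprS IH -[LHS]trmx_mul.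
Qed.

Lemma expp_comm q (X : 'M[R]_q) k :
  pconst X *m expp X k = expp X k *m pconst X.
Proof.
rewrite /expp mulmx_sumr mulmx_suml; apply: eq_bigr => l _.
rewrite -scalemxAr -scalemxAl; congr (_ *: _).
by rewrite /pconst -!map_mxM -[X *m _]exprS exprSr.
Qed.

Lemma peval0_expp q (X : 'M[R]_q) k : peval (expp X k.+1) 0 = 1%:M.
Proof.
rewrite peval_expp /series /= big_mkord big_ord_recl big1 => [|l _].
  by rewrite fact0 invr1 scale1r expr0 addr0.
by rewrite scale0r exprS mul0r scaler0.
Qed.

Lemma entry_expr_le q (X : 'M[R]_q) c l : 0 <= c ->
  (forall i j, `|X i j| <= c) ->
  forall i j, `|(X ^+ l) i j| <= (q%:R * c) ^+ l.
Proof.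
move=> c0 Xc; elim: l => [|l IH] i j.
  by rewrite !expr0 mxE; case: eqP; rewrite ?normr0 ?normr1.
rewrite exprS -[_ * _]/(_ *m _) mxE; apply: le_trans (ler_norm_sum _ _ _) _.
apply: (@le_trans _ _ (\sum_(k < q) c * (q%:R * c) ^+ l)).
  by apply: ler_sum => k _; rewrite normrM ler_pM.
by rewrite sumr_const card_ord -[leLHS]mulr_natl mulrA -exprS.
Qed.

(** For [t] in [[0, T]] the entries of the [l]-th term are dominated by the [l]-th term of the
    scalar exponential series at [T * (q * c)], where [c] bounds the entries of [X]. *)
Lemma expmx_ucvg q (X : 'M[R]_q) T :
  ucvg T (fun k => peval (expp X k)) (fun t => expmx (t *: X)).
Proof.
have [c c0 Xc] := mxbnd_ge0 (mxbnd_cst 0 X).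
have {}Xc i j : `|X i j| <= c by apply: (Xc 0); rewrite lexx.
pose a := exp_coeff (T * (q%:R * c)).
have ca : cvgn (series a) := is_cvg_series_exp_coeff _.
have main t : 0 <= t <= T -> forall k i j,
    `|expmx (t *: X) i j - peval (expp X k) t i j| <=
      limn (series a) - series a k.
  move=> /andP[t0 tT].
  have T0 : 0 <= T := le_trans t0 tT.
  pose u i j l : R := (l`!%:R^-1 *: (t *: X) ^+ l) i j.
  have ua i j l : `|u i j l| <= a l.
    rewrite /u exprZmx scalerA mxE normrM /a /exp_coeff /=.
    rewrite ger0_norm ?mulr_ge0 ?exprn_ge0 // exprMn [leRHS]mulrC -mulrA.
    rewrite ler_wpM2l ?invr_ge0 // ler_pM ?exprn_ge0 //.
      by rewrite lerXn2r ?nnegrE.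
    exact: entry_expr_le.
  pose L i j := sval (cid (series_dominated (ua i j) ca)).
  have LP i j := svalP (cid (series_dominated (ua i j) ca)).
  have sE i j k :
      series (fun l => l`!%:R^-1 *: (t *: X) ^+ l) k i j = series (u i j) k.
    by rewrite /series /= summxE.
  have -> : expmx (t *: X) = \matrix_(i, j) L i j.
    apply: cvg_lim; first exact: norm_hausdorff.
    apply: cvg_mx => i j; rewrite mxE.
    under eq_fun do rewrite sE.
    by have [] := LP i j.
  by move=> k i j; rewrite mxE peval_expp sE; have [_] := LP i j; apply.
split.
  exists (limn (series a)) => t t0 i j.
  have := main t t0 0%N i j; rewrite peval_expp.
  by rewrite /series /= !big_geq // mxE !subr0.
move=> e e0; have /cvgrPdist_le/(_ e e0)[K _ HK] := ca.
exists K => k Kk t t0 i j; rewrite distrC.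
apply: le_trans (main t t0 k i j) _.
by apply: le_trans (ler_norm _) _; apply: HK.
Qed.

Lemma itv0_refl (t : R) : 0 <= t -> 0 <= t <= t.
Proof. by move=> ->; rewrite lexx. Qed.

Lemma expmx_tr q (X : 'M[R]_q) t : 0 <= t ->
  expmx (t *: X^T) = (expmx (t *: X))^T.
Proof.
move=> /itv0_refl t0.
have H : ucvg t (fun k => peval (expp X^T k)) (fun s => (expmx (s *: X))^T).
  apply: ucvg_ext (ucvg_tr (expmx_ucvg X t)) => // k s.
  by rewrite -peval_tr expp_tr.
exact: (ucvg_unique t0 (expmx_ucvg X^T t) H).
Qed.

Lemma expmx_comm q (X : 'M[R]_q) t : 0 <= t ->
  X *m expmx (t *: X) = expmx (t *: X) *m X.
Proof.
move=> /itv0_refl t0.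
have cX := ucvg_cst (mxbnd_cst t X); have E := expmx_ucvg X t.
have H : ucvg t (fun k s => X *m peval (expp X k) s)
    (fun s => expmx (s *: X) *m X).
  apply: ucvg_ext (ucvgM E cX) => // k s.
  by rewrite -{2 3}(peval_pconst X s) -!pevalM expp_comm.
exact: (ucvg_unique t0 (ucvgM cX E) H).
Qed.

Lemma expmx0 q (X : 'M[R]_q) : expmx (0 *: X) = 1%:M.
Proof.
have t0 := itv0_refl (lexx (0 : R)).
have H : ucvg 0 (fun k => peval (expp X k.+1)) (fun=> 1%:M).
  split; first exact: mxbnd_cst.
  move=> e e0; exists 0%N => k _ t; rewrite -eq_le => /eqP <- i j.
  by rewrite peval0_expp subrr normr0 ltW.
exact: (ucvg_unique t0 (ucvg_shift (expmx_ucvg X 0)) H).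
Qed.

(** Truncating at [k.+1] keeps the constant term of the series, so the value at 0 is exactly that of
    [W]. *)
Definition conjp q (X : 'M[R]_q) (W : 'M[{poly R}]_q) (k : nat) :=
  expp X k.+1 *m W *m (expp X k.+1)^T.

Lemma conjp_ucvg q (X : 'M[R]_q) W T :
  ucvg T (fun k => peval (conjp X W k))
    (fun t => expmx (t *: X) *m peval W t *m (expmx (t *: X))^T).
Proof.
have E := ucvg_shift (expmx_ucvg X T).
have := ucvgM (ucvgM E (ucvg_cst (mxbnd_peval T W))) (ucvg_tr E).
by apply: ucvg_ext => // k t; rewrite /conjp !pevalM peval_tr.
Qed.

(** Differentiating a truncation lowers its order by one, so the product rule mixes the orders [k]
    and [k.+1]; both converge to the same exponential. *)
Lemma pderiv_conjp_ucvg q (X : 'M[R]_q) W T :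
  ucvg T (fun k => peval (pderiv (conjp X W k)))
    (fun t => expmx (t *: X) *m (X *m peval W t + peval (pderiv W) t
                + peval W t *m X^T) *m (expmx (t *: X))^T).
Proof.
have E := expmx_ucvg X T; have ES := ucvg_shift E.
have cst p r (Y : 'M[{poly R}]_(p, r)) := ucvg_cst (mxbnd_peval T Y).
have H1 := ucvgM (ucvgM E (ucvgM (cst _ _ (pconst X)) (cst _ _ W)))
  (ucvg_tr ES).
have H2 := ucvgM (ucvgM ES (cst _ _ (pderiv W))) (ucvg_tr ES).
have H3 := ucvgM (ucvgM ES (ucvgM (cst _ _ W) (cst _ _ (pconst X^T))))
  (ucvg_tr E).
have := ucvgD (ucvgD H1 H2) H3.
apply: ucvg_ext => [k t|t t0]; last first.
  by rewrite !peval_pconst -!mulmxDl -!mulmxDr.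
rewrite /conjp !pderivM pderiv_tr pderiv_expp expp_comm trmx_mul.
by rewrite !(pevalD, pevalM, peval_tr, peval_pconst) mulmxDl !mulmxA.
Qed.

(** The derivative of the product tends to 0, so each entry is both nonincreasing and nondecreasing,
    and the product keeps its value at 0. *)
Lemma expmxK q (X : 'M[R]_q) t : 0 <= t ->
  expmx (t *: - X) *m expmx (t *: X) = 1%:M.
Proof.
move=> t0.
have t1 := itv0_refl t0.
have E := expmx_ucvg X t; have ES := ucvg_shift E.
have F := expmx_ucvg (- X) t; have FS := ucvg_shift F.
pose P k := expp (- X) k.+1 *m expp X k.+1.
have PG : ucvg t (fun k => peval (P k))
    (fun s => expmx (s *: - X) *m expmx (s *: X)).
  by apply: ucvg_ext (ucvgM FS ES) => // k s; rewrite /P pevalM.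
have PH : ucvg t (fun k => peval (pderiv (P k))) (fun=> 0).
  have cX := ucvg_cst (mxbnd_cst t X).
  have cN := ucvg_cst (mxbnd_cst t (- X)).
  have := ucvgD (ucvgM (ucvgM F cN) ES) (ucvgM FS (ucvgM cX E)).
  apply: ucvg_ext => [k s|s s0]; last first.
    by rewrite mulmxN mulNmx mulmxA addNr.
  rewrite /P pderivM !pderiv_expp expp_comm !(pevalD, pevalM).
  by rewrite !peval_pconst.
have NPG : ucvg t (fun k => peval (- P k))
    (fun s => - (expmx (s *: - X) *m expmx (s *: X))).
  by apply: ucvg_ext (ucvgN PG) => // k s; rewrite pevalN.
have NPH : ucvg t (fun k => peval (pderiv (- P k))) (fun=> - 0).
  apply: ucvg_ext (ucvgN PH) => // k s.
  by rewrite -pevalN /pderiv raddfN.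
apply/matrixP => i j.
have P0 : expmx (0 *: - X) *m expmx (0 *: X) = 1%:M.
  by rewrite !expmx0 mulmx1.
apply/le_anti/andP; split.
  rewrite -[in leRHS]P0.
  apply: (ucvg_nonincr t1 PG PH) => s _; by rewrite mxE.
rewrite -[in leLHS]P0 -lerN2.
have : (- (expmx (t *: - X) *m expmx (t *: X))) i j <=
    (- (expmx (0 *: - X) *m expmx (0 *: X))) i j.
  by apply: (ucvg_nonincr t1 NPG NPH) => s _; rewrite !mxE oppr0.
by rewrite [leLHS]mxE [leRHS]mxE.
Qed.

End Exponential.

(** * Block matrices and Schur complements *)

Section BlockMatrices.
Variable R : realType.
Implicit Types (n m q N : nat).

Lemma dot_mxcol N (p_ : 'I_N -> nat) (a b : forall j, 'cV[R]_(p_ j)) :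
  dot (\mxcol_j a j) (\mxcol_j b j) = \sum_j dot (a j) (b j).
Proof. by rewrite /dot tr_mxcol mul_mxrow_mxcol summxE. Qed.

Lemma posdef_mxdiag N (p_ : 'I_N -> nat) (D : forall j, 'M[R]_(p_ j)) :
  (forall j, posdefmx (D j)) -> posdefmx (\mxdiag_j D j).
Proof.
move=> D0; apply/posdefmxP; split.
  rewrite tr_mxdiag; apply: eq_mxdiag => j.
  by have [] := D0 j.
move=> x x0; rewrite -(submxcolK x) mul_mxdiag_mxcol dot_mxcol.
have D1 j y : 0 <= dot y (D j *m y).
  have [->|y0] := eqVneq y 0; first by rewrite mulmx0 /dot mulmx0 mxE.
  by rewrite ltW // ((posdefmxP _).1 (D0 j)).2.
rewrite lt_neqAle sumr_ge0 // andbT eq_sym; apply: contra x0.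
rewrite psumr_eq0 // => /allP x0; rewrite -(submxcolK x); apply/eqP.
rewrite -mxcol0; apply: eq_mxcol => j; apply/eqP.
have := x0 j (mem_index_enum _); apply: contraLR => /= xj.
by rewrite gt_eqF // ((posdefmxP _).1 (D0 j)).2.
Qed.

Lemma mulmx_mxdiag N (p_ : 'I_N -> nat) (D E : forall j, 'M[R]_(p_ j)) :
  \mxdiag_j D j *m \mxdiag_j E j = \mxdiag_j (D j *m E j).
Proof.
rewrite [X in _ *m X]/mxdiag mul_mxdiag_mxblock /mxdiag.
apply: eq_mxblock => i j; case: eqVneq => [->|_]; last by rewrite mulmx0.
by rewrite !conform_mx_id.
Qed.

Lemma invmx_mxdiag N (p_ : 'I_N -> nat) (D : forall j, 'M[R]_(p_ j)) :
  (forall j, D j \in unitmx) -> invmx (\mxdiag_j D j) = \mxdiag_j invmx (D j).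
Proof.
move=> Du; have DV : \mxdiag_j D j *m \mxdiag_j invmx (D j) = 1%:M.
  by rewrite mulmx_mxdiag -mxdiagZ; apply: eq_mxdiag => j; rewrite mulmxV.
have [DDu _] := mulmx1_unit DV.
by rewrite -[LHS]mulmx1 -DV mulKmx.
Qed.

(** The vector with second block [- invmx D *m (V *m u)] minimises the block form for given [u]; it
    annihilates the second block row. *)
Lemma schur_dot p q (S : 'M[R]_q) (V : 'M[R]_(p, q)) (D : 'M[R]_p) u :
  posdefmx D ->
  (forall x, 0 <= dot x (block_mx S V^T V D *m x)) ->
  dot (V *m u) (invmx D *m (V *m u)) <= dot u (S *m u).
Proof.
move=> Dpos /(_ (col_mx u (- (invmx D *m (V *m u))))).
have Du := posdef_unit Dpos.
rewrite mul_block_col /dot tr_col_mx mul_row_col mxE -!/(dot _ _).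
rewrite !mulmxN mulKVmx // subrr [dot _ 0]/dot mulmx0 mxE addr0.
rewrite dotDr dotNr -dot_adj; lra.
Qed.

(** Block elimination writes the matrix as a congruence of the Schur complement plus a congruence of
    [invmx D], and each is a Gram matrix. *)
Lemma schur_SOS p q (S : 'M[R]_q) (V : 'M[R]_(p, q)) (D : 'M[R]_p) :
  posdefmx D -> posdefmx (S - V^T *m invmx D *m V) ->
  SOSmx (pconst (block_mx S V^T V D)).
Proof.
move=> Dpos; set C := S - _ => Cpos; have Du := posdef_unit Dpos.
have DT : D^T = D by have [] := Dpos.
have -> : block_mx S V^T V D =
    (row_mx 1%:M 0)^T *m C *m row_mx 1%:M 0
    + (row_mx V D)^T *m invmx D *m row_mx V D.
  rewrite !tr_row_mx (mul_col_mx _ _ C) (mul_col_mx _ _ (invmx D)).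
  rewrite !mul_col_row trmx1 trmx0 !mul1mx !mul0mx !mulmx1 !mulmx0.
  rewrite add_block_mx DT !add0r mulmxV // !mul1mx.
  rewrite -[V^T *m invmx D *m D]mulmxA mulVmx // mulmx1.
  by rewrite /C subrK.
have pconstD (A B : 'M[R]_(q + p)) : pconst (A + B) = pconst A + pconst B.
  by rewrite /pconst raddfD.
rewrite pconstD; apply: SOSmxD; rewrite /pconst !map_mxM -map_trmx.
  exact/SOSmx_congr/SOSmx_posdef.
exact/SOSmx_congr/SOSmx_posdef/posdef_inv.
Qed.

(** Under the linearizing change of variables [U j = K j *m S], every block of [Vcol] is a scaled
    [Jbar (J j) (K j) *m S], and the square roots of the weights meet in pairs. *)
Lemma Vcol_gram n m N (J : 'I_N -> 'M[R]_n) (p : 'I_N -> R)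
    (S : 'M[R]_(n + m)) (U : 'I_N -> 'M[R]_(m, n + m))
    (K : 'I_N -> 'M[R]_(m, n + m)) (P : 'I_N -> 'M[R]_(n + m)) :
  (forall j, 0 <= p j) -> (forall j, U j = K j *m S) ->
  (Vcol J p S U)^T *m (\mxdiag_(j < N) P j) *m Vcol J p S U =
  S^T *m (\sum_(j < N) p j *: ((Jbar (J j) (K j))^T *m P j *m Jbar (J j) (K j)))
    *m S.
Proof.
move=> p0 UE; rewrite /Vcol tr_mxcol -mulmxA mul_mxdiag_mxcol mul_mxrow_mxcol.
rewrite mulmx_sumr mulmx_suml; apply: eq_bigr => j _.
have -> : Jbar0 m (J j) *m S + Jbar1 R n m *m U j = Jbar (J j) (K j) *m S.
  by rewrite /Jbar UE mulmxDl mulmxA.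
rewrite [(Num.sqrt _ *: _)^T]linearZ /= -scalemxAl -!scalemxAr scalerA -expr2.
by rewrite sqr_sqrtr // trmx_mul -scalemxAl !mulmxA.
Qed.

End BlockMatrices.

(** * Lyapunov inequalities along the flow *)

Section LyapunovInequalities.
Variable R : realType.
Implicit Types (q : nat).

(** The vector [x] is multiplied into the approximants on both sides, so that entrywise monotonicity
    applies to a 1 by 1 matrix. *)
Lemma lyapunov_decr q (S : 'M[{poly R}]_q) (X : 'M[R]_q) T t x :
  (forall s, 0 <= s <= T ->
    lowbd 0 (peval (- pderiv S - (S *m pconst X^T + pconst X *m S)) s)) ->
  0 <= t <= T ->
  dot x (expmx (t *: X) *m peval S t *m (expmx (t *: X))^T *m x)
    <= dot x (peval S 0 *m x).
Proof.
move=> SX tT.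
have cx := ucvg_cst (mxbnd_cst T x); have cxT := ucvg_cst (mxbnd_cst T x^T).
pose P k := pconst x^T *m conjp X S k *m pconst x.
have PG := ucvgM (ucvgM cxT (conjp_ucvg X S T)) cx.
have PH := ucvgM (ucvgM cxT (pderiv_conjp_ucvg X S T)) cx.
have P1 k s : x^T *m peval (conjp X S k) s *m x = peval (P k) s.
  by rewrite /P !pevalM !peval_pconst.
have P2 k s : x^T *m peval (pderiv (conjp X S k)) s *m x =
    peval (pderiv (P k)) s.
  rewrite /P !pderivM !pderiv_pconst.
  by rewrite mul0mx add0r mulmx0 addr0 !pevalM !peval_pconst.
have {}PG := ucvg_ext P1 (fun t _ => erefl) PG.
have {}PH := ucvg_ext P2 (fun t _ => erefl) PH.
have := ucvg_nonincr (i := 0) (j := 0) tT PG PH.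
rewrite expmx0 trmx1 mul1mx mulmx1 /dot !mulmxA; apply=> s sT.
have := SX s sT ((expmx (s *: X))^T *m x).
rewrite mul0r dot_adj trmxK !(pevalD, pevalN, pevalM, peval_pconst).
move: (expmx _) (peval S s) (peval (pderiv S) s) => E Y Y'.
have -> : - Y' - (Y *m X^T + X *m Y) = - (X *m Y + Y' + Y *m X^T).
  by rewrite -opprD (addrC (Y *m _)) addrA (addrC Y').
by rewrite mulNmx mulmxN dotNr oppr_ge0 /dot !mulmxA.
Qed.

(** As [E] is invertible with inverse [F], the vector [E^T *m y] is nonzero whenever [y] is. *)
Lemma dominates_conj_posdef q (S0 P E F : 'M[R]_q) eps :
  0 < eps -> lowbd eps P -> F *m E = 1%:M -> S0^T = S0 ->
  (forall y, dot y (E *m P *m E^T *m y) <= dot y (S0 *m y)) -> posdefmx S0.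
Proof.
move=> e0 Pe FE S0T hS; apply/posdefmxP; split=> // y y0.
apply: lt_le_trans (hS y); rewrite -!mulmxA -{1}(trmxK E) -dot_adj.
apply: lt_le_trans (Pe _); rewrite mulr_gt0 // dot_gt0 //.
apply: contra y0 => /eqP z0; rewrite -(mul1mx y) -trmx1.
by rewrite -(mulmx1C FE) trmx_mul -mulmxA z0 mulmx0.
Qed.

(** With [w = E^T *m z], the hypotheses at [z] bound both the left side and
    [dot w (P *m w) + eps * dot w w] by [dot w x]; Young's inequality eliminates [w]. *)
Lemma lmi_inverse q (S0 P M E : 'M[R]_q) eps x :
  0 < eps -> posdefmx P -> posdefmx S0 ->
  (forall y, dot y (E *m (P + eps%:M) *m E^T *m y) <= dot y (S0 *m y)) ->
  (forall y, dot (S0 *m y) (M *m (S0 *m y)) <= dot y (S0 *m y)) ->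
  x != 0 -> dot (E *m x) (M *m (E *m x)) < dot x (invmx P *m x).
Proof.
move=> e0 Ppos S0pos hS hM x0.
have S0u := posdef_unit S0pos.
pose z := invmx S0 *m (E *m x); pose w := E^T *m z.
have zE : S0 *m z = E *m x by rewrite mulKVmx.
have := hM z; rewrite zE => h1.
have := hS z; rewrite -!mulmxA -{1}(trmxK E) -dot_adj zE -/w.
rewrite mulmxDl dotDr dot_scalar => h2.
have zw : dot z (E *m x) = dot w x by rewrite dotC dot_adj dotC.
rewrite zw in h1 h2.
have h3 := posdef_young w x Ppos.
have Px : 0 < dot x (invmx P *m x).
  by have /posdefmxP[_] := posdef_inv Ppos; apply.
(* Strictness comes from the [eps] term if [w] is nonzero, and from positivity of [invmx P] if it is
   zero. *)
have [w0|w0] := eqVneq w 0.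
  by apply: le_lt_trans h1 _; rewrite w0 /dot trmx0 mul0mx mxE.
have := mulr_gt0 e0 (dot_gt0 w0); lra.
Qed.

(** The inverse flow is bounded on [[0, T]], so conjugation by the flow cannot shrink the form of
    [Q] by more than a fixed factor. *)
Lemma conj_lowbd q (X Q : 'M[R]_q) T : posdefmx Q ->
  exists2 c, 0 < c & forall t, 0 <= t <= T ->
    lowbd c (expmx (t *: X) *m Q *m (expmx (t *: X))^T).
Proof.
move=> /posdef_lowbd[a a0 Qa].
have [Eb _] := expmx_ucvg (- X) T.
have [C C0 EC] := mxbnd_dot (mxbnd_tr Eb).
exists (a / C); first by rewrite divr_gt0.
move=> t tT x; have /andP[t0 _] := tT.
set G := expmx (t *: X); set y := G^T *m x.
have xE : x = (expmx (t *: - X))^T *m y.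
  rewrite /y mulmxA -trmx_mul; have := expmxK (- X) t0.
  by rewrite opprK -/G => ->; rewrite trmx1 mul1mx.
have -> : dot x (G *m Q *m G^T *m x) = dot y (Q *m y).
  by rewrite /y -!mulmxA (dot_adj G^T) trmxK.
apply: le_trans (Qa y); rewrite mulrAC ler_pdivrMr // -mulrA ler_pM2l // mulrC.
by rewrite [in leLHS]xE EC.
Qed.

(** Inverting both sides of the strict inequality reverses it, with a uniform margin by compactness.
    Since [M] may be singular, it is first shifted by a small [d]. *)
Lemma lmi_forward q (X M P : 'M[R]_q) a b :
  0 <= a -> M^T = M -> lowbd 0 M -> posdefmx P ->
  (forall t, a <= t <= b ->
    negdefmx (expmx (t *: X^T) *m M *m expmx (t *: X) - P)) ->
  exists d, [/\ 0 < d, posdefmx (M + d%:M) & exists2 c, 0 < c &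
    forall t, a <= t <= b ->
      lowbd c (expmx (t *: - X) *m invmx (M + d%:M) *m (expmx (t *: - X))^T
               - invmx P)].
Proof.
move=> a0 MT M0 Ppos Xneg.
have Pu := posdef_unit Ppos; have [PT _] := Ppos.
have E := expmx_ucvg X b; have [Eb _] := E.
have [C C0 EC] := mxbnd_dot Eb.
pose G t := P - (expmx (t *: X))^T *m M *m expmx (t *: X).
pose F k := pconst P - (expp X k)^T *m pconst M *m expp X k.
have FG : ucvg b (fun k => peval (F k)) G.
  have cP := ucvg_cst (mxbnd_cst b P); have cM := ucvg_cst (mxbnd_cst b M).
  apply: ucvg_ext (ucvgD cP (ucvgN (ucvgM (ucvgM (ucvg_tr E) cM) E))) => // k t.
  by rewrite /F pevalD pevalN !pevalM peval_tr !peval_pconst.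
have [|c c0 Gc] := ucvg_posdef a0 (lexx b) FG.
  move=> t /[dup] /andP[at_ _] /Xneg[NT Nx].
  rewrite expmx_tr ?(le_trans a0) // in NT Nx.
  have GE : G t = - ((expmx (t *: X))^T *m M *m expmx (t *: X) - P).
    by rewrite opprB.
  apply/posdefmxP; rewrite GE; split; first by rewrite linearN /= NT.
  by move=> x /Nx; rewrite mulNmx dotNr /dot mulmxA oppr_gt0.
(* Chosen so that the shift, transported by the flow, uses up at most half of the margin [c]. *)
pose d := c / (2 * C).
have d0 : 0 < d by rewrite divr_gt0 // mulr_gt0.
have MdT : (M + d%:M)^T = M + d%:M by rewrite linearD /= MT tr_scalar_mx.
have Mdpos : posdefmx (M + d%:M).
  apply: (lowbd_posdef MdT d0); rewrite -[d in lowbd d _]add0r.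
  by apply: lowbdD => //; exact: lowbd_scalar.
exists d; split=> //.
have [C' C'0 PC] := mxbnd_dot (mxbnd_cst 0 P).
exists (c / 2 / C'); first by rewrite !divr_gt0.
move=> t tab x; have /andP[at_ tb] := tab.
have t0 : 0 <= t := le_trans a0 at_.
have tT : 0 <= t <= b by rewrite t0.
set Ht := expmx (t *: - X); set Et := expmx (t *: X).
pose w := invmx P *m x; pose z := Ht^T *m x.
have Ez : Et^T *m z = x.
  by rewrite /z mulmxA -trmx_mul expmxK // trmx1 mul1mx.
have xw : x = P *m w by rewrite mulKVmx.
have := posdef_young z (Et *m w) (posdef_inv Mdpos).
rewrite invmxK (mulmxDl M) dotDr dot_scalar.
have zE : dot z (Et *m w) = dot x w by rewrite dotC dot_adj Ez dotC.
have -> : dot z (invmx (M + d%:M) *m z) =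
    dot x (Ht *m invmx (M + d%:M) *m Ht^T *m x).
  by rewrite /z -!mulmxA (dot_adj Ht^T) trmxK.
rewrite zE mulmxBl dotDr dotNr -/w.
have := Gc t tab w; rewrite /G mulmxBl dotDr dotNr -xw (dotC w).
have -> : dot w (Et^T *m M *m Et *m w) = dot (Et *m w) (M *m (Et *m w)).
  by rewrite dot_adj !mulmxA.
have := EC t tT w; rewrite -/Et => h1 h2 h3.
have h4 : d * dot (Et *m w) (Et *m w) <= c / 2 * dot w w.
  apply: le_trans (ler_wpM2l (ltW d0) h1) _.
  rewrite mulrA ler_wpM2r ?dot_ge0 //.
  by rewrite /d; have -> : c / (2 * C) * C = c / 2 by field; rewrite gt_eqF.
have h5 : c / 2 / C' * dot x x <= c / 2 * dot w w.
  rewrite mulrAC ler_pdivrMr // -[leRHS]mulrA ler_pM2l ?divr_gt0 // mulrC.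
  by rewrite [in leLHS]xw; apply: (PC 0); rewrite lexx.
by move: h2 h3 h4 h5; lra.
Qed.

(** Transporting [Q] along the flow solves the Lyapunov equation exactly; the decreasing factor
    [1 - eta * t] makes it a strict inequality, which survives truncation. *)
Lemma lyapunov_poly q (X Q Y : 'M[R]_q) a b c :
  0 <= a -> 0 < b -> posdefmx Q -> 0 < c ->
  (forall t, a <= t <= b ->
    lowbd c (expmx (t *: X) *m Q *m (expmx (t *: X))^T - Y)) ->
  exists (S : 'M[{poly R}]_q) (c' : R), [/\ 0 < c', S^T = S, peval S 0 = Q,
    forall t, 0 <= t <= b -> lowbd c'
      (peval (- pderiv S - (S *m pconst (- X)^T + pconst (- X) *m S)) t) &
    forall t, a <= t <= b -> lowbd c' (peval S t - Y)].
Proof.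
move=> a0 b0 Qpos c0 hc.
have [QT _] := Qpos.
have [c1 c10 hc1] := conj_lowbd X b Qpos.
have E := expmx_ucvg X b; have [Eb _] := E.
have [Cb C0 hC] : exists2 C, 0 < C & forall t, 0 <= t <= b -> forall x,
    dot x (expmx (t *: X) *m Q *m (expmx (t *: X))^T *m x) <= C * dot x x.
  have Gb := mxbndM (mxbndM Eb (mxbnd_cst b Q)) (mxbnd_tr Eb).
  have [C C0 GC] := mxbnd_ge0 Gb.
  exists (C * q%:R + 1); first by rewrite ltr_wpDl // mulr_ge0.
  move=> t tb x; apply: le_trans (ler_norm _) _.
  apply: le_trans (dot_mx_le _ (GC t tb)) _.
  by rewrite ler_wpM2r ?dot_ge0 // lerDl.
(* On [[0, b]] the factor then removes at most [c / 2] from the margin at the end. *)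
pose eta := c / 2 / (b * Cb).
have eta0 : 0 < eta by rewrite !divr_gt0 // mulr_gt0.
pose W := (1 - eta *: 'X : {poly R}) *: pconst Q.
have Wt t : peval W t = (1 - eta * t) *: Q.
  by rewrite pevalZ peval_pconst !hornerE.
have W't t : peval (pderiv W) t = - eta *: Q.
  apply/matrixP => i j; rewrite !mxE /horner_eval derivM derivC mulr0 addr0.
  by rewrite derivB derivZ derivX derivC sub0r !hornerE.
have WT : W^T = W by rewrite /W linearZ /= /pconst map_trmx QT.
pose S k := conjp X W k.
have SG := conjp_ucvg X W b.
have SH := pderiv_conjp_ucvg X W b.
pose L k := - pderiv (S k) - (S k *m pconst (- X)^T + pconst (- X) *m S k).
(* In the limit the terms in [X] cancel, since [X] commutes with its exponential; only the
   derivative of the scalar factor remains. *)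
have LG : ucvg b (fun k => peval (L k))
   (fun t => eta *: (expmx (t *: X) *m Q *m (expmx (t *: X))^T)).
  have cX := ucvg_cst (mxbnd_cst b (- X)^T).
  have cX' := ucvg_cst (mxbnd_cst b (- X)).
  have := ucvgD (ucvgN SH) (ucvgN (ucvgD (ucvgM SG cX) (ucvgM cX' SG))).
  apply: ucvg_ext => [k t|t /andP[t0 _]].
    by rewrite /L !(pevalD, pevalN, pevalM, peval_pconst).
  rewrite W't Wt; set Et := expmx _; set v := (1 - _).
  have comm : X *m Et = Et *m X by rewrite expmx_comm.
  have commT : Et^T *m X^T = X^T *m Et^T by rewrite -!trmx_mul comm.
  have e1 : Et *m (v *: Q) *m Et^T *m (- X)^T =
      - (Et *m (v *: Q *m X^T) *m Et^T).
    by rewrite linearN /= mulmxN -[_ *m Et^T *m X^T]mulmxA commT !mulmxA.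
  have e2 : - X *m (Et *m (v *: Q) *m Et^T) = - (Et *m (X *m (v *: Q)) *m Et^T).
    by rewrite mulNmx !mulmxA comm.
  rewrite e1 e2 [- (- _ - _)]opprD !opprK !(mulmxDl, mulmxDr).
  move: (Et *m (X *m _) *m _) (Et *m (v *: Q *m _) *m _) => a1 a3.
  rewrite (addrAC a1) (addrC a3) [LHS]addrC opprD addrA subrr add0r.
  by rewrite scaleNr mulmxN mulNmx opprK -scalemxAr -scalemxAl.
have S0 k : peval (S k) 0 = Q.
  rewrite /S /conjp !pevalM peval_tr peval0_expp trmx1 mul1mx mulmx1.
  by rewrite Wt mulr0 subr0 scale1r.
have ST k : (S k)^T = S k by rewrite /S /conjp !trmx_mul trmxK WT mulmxA.
have [|||K1 HK1] := ucvg_lowbd LG (D := fun t => 0 <= t <= b) (c := eta * c1).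
- by [].
- by rewrite mulr_gt0.
- move=> t tb x; rewrite -scalemxAl dotZr -mulrA ler_pM2l //; exact: hc1.
have SYG := ucvgD SG (ucvg_cst (mxbnd_cst b (- Y))).
have [|||K2 HK2] := ucvg_lowbd SYG (D := fun t => a <= t <= b) (c := c / 2).
- by move=> t /andP[at_ ->]; rewrite (le_trans a0 at_).
- by rewrite divr_gt0.
- move=> t tab x; have /andP[at_ tb] := tab.
  have tb0 : 0 <= t <= b by rewrite (le_trans a0 at_).
  have := hc t tab x; have := hC t tb0 x; rewrite Wt -scalemxAr -scalemxAl.
  rewrite !mulmxDl !dotDr -scalemxAl dotZr.
  set u := dot x (_ *m x); set y := dot x (- Y *m x).
  move=> h1 h2.
  have -> : (1 - eta * t) * u = u - t * (eta * u) by ring.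
  have tb' : t * (eta * Cb) <= c / 2.
    apply: (@le_trans _ _ (b * (eta * Cb))).
      by rewrite ler_wpM2r // mulr_ge0 ?ltW.
    rewrite le_eqVlt; apply/orP; left; apply/eqP; rewrite /eta.
    by field; rewrite !gt_eqF.
  have := ler_wpM2r (dot_ge0 x) tb'.
  have /andP[t0 _] := tb0.
  have := dot_ge0 x; have := ler_wpM2l (mulr_ge0 t0 (ltW eta0)) h1.
  clearbody u y; move: h1 h2; move: (dot x x) => n; lra.
pose k := maxn K1 K2.
exists (S k), (Num.min (eta * c1 / 2) (c / 2 / 2)); split=> //.
- have ec : 0 < eta * c1 by rewrite mulr_gt0.
  by rewrite lt_min (divr_gt0 ec) //= !divr_gt0.
- move=> t tb; apply: lowbd_le (HK1 k (leq_maxl _ _) t tb).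
  by rewrite ge_min lexx.
- move=> t tab; apply: lowbd_le (HK2 k (leq_maxr _ _) t tab).
  by rewrite ge_min lexx orbT.
Qed.

End LyapunovInequalities.

(** * The jump term and the two implications *)

Section Assembly.
Variable R : realType.
Variables (n m N : nat) (J : 'I_N -> 'I_N -> 'M[R]_n).
Implicit Types (P : 'I_N -> 'M[R]_(n + m)).
Implicit Types (K : 'I_N -> 'I_N -> 'M[R]_(m, n + m)).

Definition jumpmx P K (Pi : 'M[R]_N) i : 'M[R]_(n + m) :=
  \sum_(j < N) Pi j i *:
    ((Jbar (J j i) (K j i))^T *m P j *m Jbar (J j i) (K j i)).

Lemma jumpmx_sym P K (Pi : 'M[R]_N) i : (forall j, (P j)^T = P j) ->
  (jumpmx P K Pi i)^T = jumpmx P K Pi i.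
Proof.
move=> PT; rewrite /jumpmx linear_sum; apply: eq_bigr => j _.
by rewrite linearZ /= !trmx_mul trmxK PT mulmxA.
Qed.

Lemma jumpmx_ge0 P K (Pi : 'M[R]_N) i : (forall j, posdefmx (P j)) ->
  (forall j, 0 <= Pi j i) -> lowbd 0 (jumpmx P K Pi i).
Proof.
move=> Ppos Pi0 x; rewrite mul0r mulmx_suml dot_sumr sumr_ge0 // => j _.
rewrite -scalemxAl dotZr mulr_ge0 // -!mulmxA -dot_adj.
set y := _ *m x; have [->|y0] := eqVneq y 0.
  by rewrite mulmx0 /dot mulmx0 mxE.
by rewrite ltW // ((posdefmxP _).1 (Ppos j)).2.
Qed.

End Assembly.

Lemma gpolyE (R : realType) (T : R) : gpoly T = hpoly 0 T.
Proof. by rewrite /gpoly /hpoly polyC0 subr0. Qed.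

(** The reciprocal of one plus the sum of all [(c i)^-1] is a strict lower bound that also makes
    sense for an empty family. *)
Lemma gt0_lower_bound (R : realType) N (c : 'I_N -> R) :
  (forall i, 0 < c i) -> exists2 e, 0 < e & forall i, e < c i.
Proof.
move=> c0; pose s := 1 + \sum_i (c i)^-1.
have cV i : 0 <= (c i)^-1 by rewrite invr_ge0 ltW.
have s0 : 0 < s by rewrite ltr_pwDl // sumr_ge0.
exists s^-1; first by rewrite invr_gt0.
move=> i; rewrite invf_plt ?posrE // /s (bigD1 i) //= addrCA ltrDl.
by rewrite ltr_pwDl // sumr_ge0.
Qed.

(** The bound holds for every larger [k], so that several families can share one degree. *)
Lemma pdeg_bound (R : realType) N q (F : 'I_N -> 'M[{poly R}]_q) :
  exists d, forall i k, (d <= k)%N -> pdeg_le (F i) k.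
Proof.
exists (\max_i \max_a \max_b size (F i a b))%N => i k dk a b.
apply: leqW; apply: leq_trans dk.
rewrite (leq_trans _ (leq_bigmax i)) // (leq_trans _ (leq_bigmax a)) //.
exact: leq_bigmax b.
Qed.

(** The modes are treated separately and then share [eps] and [d], by finiteness of the family. *)
Lemma SOS_of_LMI (R : realType) (n m N : nat)
    (A : 'I_N -> 'M[R]_n) (B : 'I_N -> 'M[R]_(n, m))
    (J : 'I_N -> 'I_N -> 'M[R]_n)
    (Tmin Tmax : R) (hTmin : 0 < Tmin) (hT : Tmin <= Tmax)
    P K (Pi : 'M[R]_N) :
  (forall i, posdefmx (P i)) -> col_stochastic Pi ->
  (forall i theta, Tmin <= theta <= Tmax ->
    negdefmx (expmx (theta *: (Abar (A i) (B i))^T) *m jumpmx J P K Pi i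
              *m expmx (theta *: Abar (A i) (B i)) - P i)) ->
  exists eps d, 0 < eps /\
    exists (S Gamma Delta : 'I_N -> 'M[{poly R}]_(n + m))
      (Q : 'I_N -> 'M[R]_(n + m)) (U : 'I_N -> 'I_N -> 'M[R]_(m, n + m)),
      [/\ forall i, [/\ (S i)^T = S i, (Gamma i)^T = Gamma i,
                        (Delta i)^T = Delta i & (Q i)^T = Q i],
          forall i, [/\ pdeg_le (S i) (2 * d), pdeg_le (Gamma i) (2 * d) &
                        pdeg_le (Delta i) (2 * d)] &
          forall i,
            SOSmx (Gamma i) /\
            SOSmx (Delta i) /\
            SOSmx (pconst (Q i - eps%:M)) /\
            SOSmx (- pderiv (S i)
                   - (S i *m pconst ((Abar (A i) (B i))^T)
                      + pconst (Abar (A i) (B i)) *m S i)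
                   - gpoly Tmax *: Gamma i) /\
            SOSmx (- pconst (Q i) + S i - pconst (eps%:M)
                   - hpoly Tmin Tmax *: Delta i) /\
            SOSmx (let V := Vcol (fun j => J j i) (fun j => Pi j i)
                              (peval (S i) 0) (fun j => U j i) in
                   pconst (block_mx (peval (S i) 0) V^T
                                    V (\mxdiag_(j < N) Q j)))].
Proof.
move=> Ppos [Pi0 _] Xneg.
have PT j : (P j)^T = P j by have [] := Ppos j.
pose M i := jumpmx J P K Pi i; pose X i := Abar (A i) (B i).
have Tmax0 : 0 < Tmax := lt_le_trans hTmin hT.
(* The triple holds the polynomial [S i], a margin common to all its inequalities, and the shift
   added to [M i]. *)
have loc i : exists s : 'M[{poly R}]_(n + m) * R * R,
    [/\ [/\ s.1.1^T = s.1.1, 0 < s.1.2, 0 < s.2 & posdefmx (M i + s.2%:M)],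
        peval s.1.1 0 = invmx (M i + s.2%:M),
        lowbd s.1.2 (invmx (P i)),
        forall t, 0 <= t <= Tmax -> lowbd s.1.2
          (peval (- pderiv s.1.1
            - (s.1.1 *m pconst (X i)^T + pconst (X i) *m s.1.1)) t) &
        forall t, Tmin <= t <= Tmax ->
          lowbd s.1.2 (peval s.1.1 t - invmx (P i))].
  have M0 : lowbd 0 (M i) by apply: jumpmx_ge0.
  have MT : (M i)^T = M i by apply: jumpmx_sym.
  have [d [d0 Mdpos [c c0 hc]]] :=
    lmi_forward (ltW hTmin) MT M0 (Ppos i) (Xneg i).
  have [S [c' [c'0 ST S0 hS1 hS2]]] :=
    lyapunov_poly (ltW hTmin) Tmax0 (posdef_inv Mdpos) c0 hc.
  have [c2 c20 hc2] := posdef_lowbd (posdef_inv (Ppos i)).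
  (* [lyapunov_poly] was applied to [- X i], because the reversed inequality is transported by the
     backward flow. *)
  rewrite opprK in hS1.
  exists (S, Num.min c' c2, d); split=> //=.
  - by split=> //; rewrite lt_min c'0.
  - by apply: lowbd_le hc2; rewrite ge_min lexx orbT.
  - by move=> t /hS1; apply: lowbd_le; rewrite ge_min lexx.
  - by move=> t /hS2; apply: lowbd_le; rewrite ge_min lexx.
have {loc}[s hs] := choice loc.
pose S i := (s i).1.1; pose Q i := invmx (P i).
have [eps eps0 hc] : exists2 e, 0 < e & forall i, e < (s i).1.2.
  by apply: gt0_lower_bound => i; have [[]] := hs i.
have ST i : (S i)^T = S i by have [[]] := hs i.
have Qpos i : posdefmx (Q i) by apply: posdef_inv.
have QT i : (Q i)^T = Q i by have [] := Qpos i.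
have tr_pconst p q (Y : 'M[R]_(p, q)) : (pconst Y)^T = pconst Y^T.
  by rewrite /pconst map_trmx.
have exGamma i : qmodule (gpoly Tmax)
    (- pderiv (S i) - (S i *m pconst (X i)^T + pconst (X i) *m S i)).
  have [[_ c0 _ _] _ _ hS _] := hs i.
  rewrite gpolyE; apply: qmodule_itv c0 _ (ltW Tmax0) hS.
  rewrite linearB linearN linearD /= -pderiv_tr !trmx_mul !tr_pconst trmxK ST.
  by congr (_ - _); rewrite addrC.
have exDelta i : qmodule (hpoly Tmin Tmax)
    (- pconst (Q i) + S i - pconst (eps%:M)).
  have [_ _ _ _ hS] := hs i.
  apply: (@qmodule_itv _ _ ((s i).1.2 - eps)) => //.
  - by rewrite subr_gt0.
  - by rewrite linearB linearD linearN /= !tr_pconst ST QT tr_scalar_mx.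
  - move=> t /hS h x; rewrite !(pevalD, pevalN, peval_pconst).
    rewrite mulmxBl dotDr dotNr dot_scalar mulrBl lerB //.
    by have := h x; rewrite addrC.
have [Gamma hG] := choice exGamma; have [Delta hD] := choice exDelta.
have [d1 hd1] := pdeg_bound S; have [d2 hd2] := pdeg_bound Gamma.
have [d3 hd3] := pdeg_bound Delta.
exists eps, (d1 + d2 + d3)%N; split=> //.
exists S, Gamma, Delta, Q, (fun j i => K j i *m peval (S i) 0); split=> i.
- by split=> //; apply: SOSmx_sym; [case: (hG i)|case: (hD i)].
- by split; [apply: hd1|apply: hd2|apply: hd3]; lia.
have [[_ c0 d0 Mdpos] S0 hQ _ _] := hs i.
have [G1 G2] := hG i; have [D1 D2] := hD i; do !split=> //.
  apply: SOSmx_posdef; apply: (@lowbd_posdef _ _ ((s i).1.2 - eps)).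
  - by rewrite linearB /= QT tr_scalar_mx.
  - by rewrite subr_gt0.
  - by move=> x; rewrite mulmxBl dotDr dotNr dot_scalar mulrBl lerB.
apply: schur_SOS; first exact: posdef_mxdiag.
rewrite invmx_mxdiag => [|j]; last exact: posdef_unit.
rewrite (eq_mxdiag (fun j => invmxK (P j))).
rewrite (@Vcol_gram _ _ _ _ _ _ _ _ (fun j => K j i)) //.
rewrite -/(jumpmx J P K Pi i) -/(M i).
rewrite -peval_tr ST -/(S i) S0.
have Mdu := posdef_unit Mdpos; set Z := invmx _.
have [ZT _] : posdefmx Z by apply: posdef_inv.
(* Here [Z] inverts the shifted matrix, so the Schur complement is exactly the shift times
   [Z^T *m Z]. *)
have -> : Z - Z *m M i *m Z = (s i).2 *: (Z^T *m Z).
  rewrite {1}(_ : Z = Z *m (M i + (s i).2%:M) *m Z); last first.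
    by rewrite mulVmx // mul1mx.
  by rewrite ZT mulmxDr mulmxDl addrC addKr mul_mx_scalar -scalemxAl.
apply/posdefmxP; split; first by rewrite linearZ /= trmx_mul trmxK.
move=> x x0; rewrite -scalemxAl dotZr -mulmxA -dot_adj mulr_gt0 // dot_gt0 //.
apply: contra x0 => /eqP Zx; rewrite -(mul1mx x) -(mulmxV Mdu) -/Z -mulmxA Zx.
by rewrite mulmx0.
Qed.

(** On the relevant intervals [gpoly] and [hpoly] are nonnegative, so the SOS conditions become
    pointwise inequalities, to which [lyapunov_decr], [schur_dot] and [lmi_inverse] apply. *)
Lemma LMI_of_SOS (R : realType) (n m N : nat)
    (A : 'I_N -> 'M[R]_n) (B : 'I_N -> 'M[R]_(n, m))
    (J : 'I_N -> 'I_N -> 'M[R]_n)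
    (Tmin Tmax : R) (hTmin : 0 < Tmin)
    eps (S Gamma Delta : 'I_N -> 'M[{poly R}]_(n + m))
    (Q : 'I_N -> 'M[R]_(n + m)) (U : 'I_N -> 'I_N -> 'M[R]_(m, n + m))
    (Pi : 'M[R]_N) (i : 'I_N) (theta : R) :
  0 < eps -> (forall j, (S j)^T = S j) -> (forall j, (Q j)^T = Q j) ->
  col_stochastic Pi ->
  (forall i,
    SOSmx (Gamma i) /\
    SOSmx (Delta i) /\
    SOSmx (pconst (Q i - eps%:M)) /\
    SOSmx (- pderiv (S i)
           - (S i *m pconst ((Abar (A i) (B i))^T)
              + pconst (Abar (A i) (B i)) *m S i)
           - gpoly Tmax *: Gamma i) /\
    SOSmx (- pconst (Q i) + S i - pconst (eps%:M)
           - hpoly Tmin Tmax *: Delta i) /\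
    SOSmx (let V := Vcol (fun j => J j i) (fun j => Pi j i)
                      (peval (S i) 0) (fun j => U j i) in
           pconst (block_mx (peval (S i) 0) V^T
                            V (\mxdiag_(j < N) Q j)))) ->
  Tmin <= theta <= Tmax ->
  (forall j, posdefmx (Q j)) /\
  negdefmx (expmx (theta *: (Abar (A i) (B i))^T)
    *m jumpmx J (fun j => invmx (Q j))
         (fun j i => U j i *m invmx (peval (S i) 0)) Pi i
    *m expmx (theta *: Abar (A i) (B i)) - invmx (Q i)).
Proof.
move=> eps0 ST QT [Pi0 _] hS /andP[th1 th2].
have th0 : 0 <= theta by rewrite (le_trans (ltW hTmin)).
have Qe j : lowbd eps (Q j).
  have [_ [_ [/SOSmx_ge0 Qj _]]] := hS j => x.
  have := Qj 0 x.
  by rewrite peval_pconst mulmxBl dotDr dotNr dot_scalar subr_ge0.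
have Qpos j : posdefmx (Q j) := lowbd_posdef (QT j) eps0 (Qe j).
have QVT j : (invmx (Q j))^T = invmx (Q j) by have [] := posdef_inv (Qpos j).
split=> //.
have [hG [hD [_ [hdiff [hend hblock]]]]] := hS i.
set X := Abar (A i) (B i) in hdiff *; set S0 := peval (S i) 0 in hblock *.
set E := expmx (theta *: X).
have S0T : S0^T = S0 by rewrite /S0 -peval_tr ST.
have endi : lowbd 0 (peval (- pconst (Q i) + S i - pconst eps%:M) theta).
  apply: (@qmodule_ge0 _ _ (hpoly Tmin Tmax)); first by exists (Delta i).
  by rewrite /hpoly !hornerE mulr_ge0 // subr_ge0.
have diffi t : 0 <= t <= Tmax -> lowbd 0
    (peval (- pderiv (S i) - (S i *m pconst X^T + pconst X *m S i)) t).
  move=> /andP[t0 t1]; apply: (@qmodule_ge0 _ _ (gpoly Tmax)).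
    by exists (Gamma i).
  by rewrite /gpoly !hornerE mulr_ge0 // subr_ge0.
have S0ge y : dot y (E *m (Q i + eps%:M) *m E^T *m y) <= dot y (S0 *m y).
  have thT : 0 <= theta <= Tmax by rewrite th0.
  apply: le_trans (lyapunov_decr y diffi thT); rewrite -/E.
  rewrite -!mulmxA -{1 3}(trmxK E) -!(dot_adj E^T).
  have := endi (E^T *m y); rewrite mul0r !(pevalD, pevalN, peval_pconst).
  by rewrite !(mulmxDl, mulNmx) !(dotDr, dotNr); lra.
have S0pos : posdefmx S0.
  have Qee : lowbd (eps + eps) (Q i + eps%:M).
    by apply: lowbdD => //; exact: lowbd_scalar.
  exact: (dominates_conj_posdef (addr_gt0 eps0 eps0) Qee (expmxK X th0) S0T).
have S0u := posdef_unit S0pos.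
set M := jumpmx _ _ _ _ _.
have MT : M^T = M by apply: jumpmx_sym.
have SM y : dot (S0 *m y) (M *m (S0 *m y)) <= dot y (S0 *m y).
  set V := Vcol _ _ _ _ in hblock.
  have Dpos : posdefmx (\mxdiag_(j < N) Q j) by apply: posdef_mxdiag.
  have := schur_dot (S := S0) (V := V) y Dpos.
  rewrite invmx_mxdiag => [h|j]; last exact: posdef_unit.
  apply: le_trans (h _); last first.
    by move=> x; have := SOSmx_ge0 0 x hblock; rewrite peval_pconst.
  (* The gain is recovered as [U j i *m invmx S0], which is legitimate because [S0] has just been
     shown invertible. *)
  have UK j : U j i = (U j i *m invmx S0) *m S0 by rewrite mulmxKV.
  have := Vcol_gram (fun j => J j i) (fun j => invmx (Q j))
    (fun j => Pi0 j i) UK.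
  rewrite -/V -/M => VG.
  by rewrite [leRHS]dot_adj !mulmxA VG [leLHS]dot_adj !mulmxA.
apply/negdefmxP; split.
  by rewrite expmx_tr // linearB /= QVT !trmx_mul trmxK MT mulmxA.
move=> x x0; rewrite mulmxBl dotDr dotNr subr_lt0 expmx_tr // -/E.
rewrite -!mulmxA -dot_adj.
exact: lmi_inverse eps0 (Qpos i) S0pos S0ge SM x0.
Qed.

Theorem theorem13 (R : realType) (n m N : nat)
    (hn : (1 <= n)%N) (hm : (1 <= m)%N) (hN : (1 <= N)%N)
    (A : 'I_N -> 'M[R]_n) (B : 'I_N -> 'M[R]_(n, m))
    (J : 'I_N -> 'I_N -> 'M[R]_n)
    (Tmin Tmax : R) (hTmin : 0 < Tmin) (hT : Tmin <= Tmax) :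
  (exists (P : 'I_N -> 'M[R]_(n + m)) (K : 'I_N -> 'I_N -> 'M[R]_(m, n + m))
      (Pi : 'M[R]_N),
    [/\ forall i, posdefmx (P i),
        col_stochastic Pi &
        forall (i : 'I_N) (theta : R), Tmin <= theta <= Tmax ->
          negdefmx
            (expmx (theta *: (Abar (A i) (B i))^T)
             *m (\sum_(j < N) Pi j i *:
                   ((Jbar (J j i) (K j i))^T *m P j *m Jbar (J j i) (K j i)))
             *m expmx (theta *: Abar (A i) (B i))
             - P i)])
  <->
  (exists (eps : R) (d : nat), 0 < eps /\
    exists (S Gamma Delta : 'I_N -> 'M[{poly R}]_(n + m))
      (P : 'I_N -> 'M[R]_(n + m)) (U : 'I_N -> 'I_N -> 'M[R]_(m, n + m))
      (Pi : 'M[R]_N),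
      [/\ forall i, [/\ (S i)^T = S i, (Gamma i)^T = Gamma i,
                        (Delta i)^T = Delta i & (P i)^T = P i],
          forall i, [/\ pdeg_le (S i) (2 * d), pdeg_le (Gamma i) (2 * d) &
                        pdeg_le (Delta i) (2 * d)],
          col_stochastic Pi &
          forall i,
            SOSmx (Gamma i) /\
            SOSmx (Delta i) /\
            SOSmx (pconst (P i - eps%:M)) /\
            SOSmx (- pderiv (S i)
                   - (S i *m pconst ((Abar (A i) (B i))^T)
                      + pconst (Abar (A i) (B i)) *m S i)
                   - gpoly Tmax *: Gamma i) /\
            SOSmx (- pconst (P i) + S i - pconst (eps%:M)
                   - hpoly Tmin Tmax *: Delta i) /\
            SOSmx (let V := Vcol (fun j => J j i) (fun j => Pi j i)
                              (peval (S i) 0) (fun j => U j i) in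
                   pconst (block_mx (peval (S i) 0) V^T
                                    V (\mxdiag_(j < N) P j)))]).
Proof.
split=> [[P [K [Pi [Ppos hPi Xneg]]]]|[eps [d [eps0]]]]; last first.
  move=> [S [Gamma [Delta [Q [U [Pi [hsym _ hPi hS]]]]]]].
  exists (fun j => invmx (Q j)), (fun j i => U j i *m invmx (peval (S i) 0)), Pi.
  have ST j : (S j)^T = S j by have [] := hsym j.
  have QT j : (Q j)^T = Q j by have [] := hsym j.
  have main i t := LMI_of_SOS (theta := t) hTmin i eps0 ST QT hPi hS.
  split=> //.
    move=> i; apply: posdef_inv.
    (* Positive definiteness is obtained from [main], which asks for some dwell time; [Tmin] serves
       as the sample. *)
    have Tm : Tmin <= Tmin <= Tmax by rewrite lexx hT.
    by have [+ _] := main i Tmin Tm; apply.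
  by move=> i t ht; have [] := main i t ht.
have [eps [d [eps0 [S [Gamma [Delta [Q [U [h1 h2 h3]]]]]]]]] :=
  SOS_of_LMI hTmin hT Ppos hPi Xneg.
by exists eps, d; split=> //; exists S, Gamma, Delta, Q, U, Pi; split.
Qed.
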